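(* Let $-A$ be the infinitesimal generator of a semigroup $(T_t)_{t>0}$ as in the standing setting described in the context. Suppose $A$ satisfies a Nash-type inequality with non-decreasing rate function $D:[0,+\infty)\to[0,+\infty)$, i.e. for every $f\in\mathcal D(A)\cap L^1(\mu)$ with $\|f\|_1\le1$, $$\|f\|_2^2\,D(\|f\|_2^2)\le(Af,f).$$ Set, for $r>0$, $\beta(r)=\sup_{x>0}\left(x-rxD(x)\right)$, and assume that $\beta(r)$ is finite for every $r>0$. Let $g$ be a Bernstein function. (i) Then $g(A)$ satisfies the Nash-type inequality $$\|f\|_2^2\,D_{g,\beta}(\|f\|_2^2)\le(g(A)f,f),\qquad \|f\|_1\le1,$$ where, with $(r_0,r_1)=\left(\frac1{g(+\infty)},\frac1{g(0^+)}\right)$, $$D_{g,\beta}(x)=\sup_{r\in(r_0,r_1)}\left(\frac1r-\frac1{rx}\,\beta\left(\frac1{g^{-1}(1/r)}\right)\right),\qquad x>0.$$ (ii) Moreover, assume that $g$ is a bijection from $[0,+\infty)$ to itself and that $\beta:(0,+\infty)\to(0,+\infty)$ is a decreasing differentiable bijection. Then $$\|f\|_2^2\,\sup_{\rho>1}\,(1-\rho^{-1})\,(g\circ D)\left(\rho^{-1}\|f\|_2^2\right)\le(g(A)f,f),\qquad\|f\|_1\le1,$$ and, for every $x>0$, $$\sup_{\rho>1}\,(1-\rho^{-1})\,(g\circ D)(\rho^{-1}x)\le D_{g,\beta}(x)\le (g\circ D)(x).$$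
   Context: Standing setting: $(X,\mu)$ is a $\sigma$-finite measure space; $(T_t)_{t>0}$ is a strongly continuous semigroup on $L^2(X,\mu)$ such that for each $t>0$, $T_t$ is a symmetric contraction on $L^2$ and is a contraction, for the $L^1$-norm, from $L^1\cap L^2$ to itself. Its infinitesimal generator on $L^2$ is $-A$, where $-Af=\lim_{t\to0^+}(T_tf-f)/t$ on the domain $\mathcal D(A)$ of those $f\in L^2$ for which this limit exists in $L^2$; $A$ is a non-negative self-adjoint operator. $(\cdot,\cdot)$ is the inner product of $L^2(\mu)$ and $\|\cdot\|_p$ the $L^p(\mu)$-norm. A Bernstein function is a $C^\infty$ function $g:(0,+\infty)\to(0,+\infty)$ with $(-1)^{n-1}g^{(n)}(s)\ge0$ for all integers $n\ge1$ and $s>0$; $g(0^+)$, $g(+\infty)$ denote its limits, and $g(0):=g(0^+)$. It is either constant (then $(r_0,r_1)$ is empty) or strictly increasing, and then $g^{-1}:(g(0^+),g(+\infty))\to(0,+\infty)$. Conventions: $1/(+\infty)=0$, $1/0=+\infty$, $\sup\emptyset=-\infty$. For measurable $\Psi:[0,+\infty)\to\mathbb R$, $\Psi(A)=\int_0^{+\infty}\Psi(\lambda)\,dE(\lambda)$ is defined through the spectral resolution of $A$, with domain $\mathcal D(\Psi(A))=\{f\in L^2:\int_0^{+\infty}|\Psi(\lambda)|^2d(E(\lambda)f,f)<\infty\}$; $(\Psi(A)f,f):=+\infty$ if $f\notin\mathcal D(\Psi(A))$. The Nash-type inequalities for $g(A)$ are for $f\in\mathcal D(g(A))\cap L^1(\mu)$;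 for $f=0$ their left-hand side is read as $0$. *)

(* Defs.v *)
From HB Require Import structures.
From mathcomp Require Import all_boot all_order all_algebra.
From mathcomp Require Import all_classical all_reals all_analysis.

Set Implicit Arguments.
Unset Strict Implicit.
Unset Printing Implicit Defensive.
Import Order.TTheory GRing.Theory Num.Theory.
Import numFieldTopology.Exports numFieldNormedType.Exports HBSimple.

Local Open Scope classical_set_scope.
Local Open Scope ring_scope.

(* Real L^2(mu): its elements are represented by square-integrable functions,
   and equality in L^2 is equality mu-almost everywhere, so every operator law
   below is stated up to [%[ae mu]].  Scalars are real. *)
Notation L2 mu := (LfunType mu (lee1n 2)).

Section L2_operators.
Context {d : measure_display} {X : measurableType d} {R : realType}.
Context (mu : {measure set X -> \bar R}).
Implicit Types (f g h : L2 mu) (A : L2 mu -> L2 mu).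

Definition inner f g : R := \int[mu]_x (f x * g x).

Definition normsq f : R := fine ('N[mu]_2%:E[EFin \o f])%E ^+ 2.

(* Only a net tending to a limit in L^2-norm is needed, so no topology is put
   on [L2 mu]. *)
Definition cvgL2 {I : Type} (F : set_system I) (u : I -> L2 mu) (h : L2 mu) :=
  'N[mu]_2%:E[EFin \o (u i - h)%R]%E @[i --> F] --> 0%E.

Record contraction_semigroup (T : R -> L2 mu -> L2 mu) : Prop := {
  sg_linear : forall t a f g, 0 < t ->
    T t (a *: f + g) = a *: T t f + T t g %[ae mu] ;
  sg_law : forall s t f, 0 < s -> 0 < t -> T (s + t) f = T s (T t f) %[ae mu] ;
  sg_continuous : forall f, cvgL2 0^'+ (T ^~ f) f ;
  sg_symmetric : forall t f g, 0 < t -> inner (T t f) g = inner f (T t g) ;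
  sg_contraction2 : forall t f, 0 < t ->
    ('N[mu]_2%:E[EFin \o T t f] <= 'N[mu]_2%:E[EFin \o f])%E ;
  (* as [T t f] is measurable, this includes that it is integrable *)
  sg_contraction1 : forall t f, 0 < t -> (f : X -> R) \in Lfun mu 1 ->
    ('N[mu]_1[EFin \o T t f] <= 'N[mu]_1[EFin \o f])%E }.

(* Graph, domain and values of A, where -A is the generator of T. *)
Definition generator_graph (T : R -> L2 mu -> L2 mu) f h : Prop :=
  cvgL2 0^'+ (fun t => t^-1 *: (T t f - f)) (- h).

Definition generator_dom T f : Prop := exists h, generator_graph T f h.

Definition generator T f : L2 mu := xget 0 [set h | generator_graph T f h].

(* A resolution of the identity on the Borel sets of R carried by [0, +oo[;
   E(lambda) is [pv_proj `]-oo, lambda]].  The measure d(E(lambda) f, f) is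
   [pv_meas f]: on Borel sets it is determined by [pv_proj], and its existence
   is the countable additivity of B |-> (E(B) f, f). *)
Record spectral_family := SpectralFamily {
  pv_proj :> set R -> L2 mu -> L2 mu ;
  pv_meas : L2 mu -> {measure set R -> \bar R} ;
  pv_linear : forall B a f g, measurable B ->
    pv_proj B (a *: f + g) = a *: pv_proj B f + pv_proj B g %[ae mu] ;
  pv_symmetric : forall B f g, measurable B ->
    inner (pv_proj B f) g = inner f (pv_proj B g) ;
  pv_setI : forall B C f, measurable B -> measurable C ->
    pv_proj (B `&` C) f = pv_proj B (pv_proj C f) %[ae mu] ;
  pv_setT : forall f, pv_proj [set: R] f = f %[ae mu] ;
  pv_measE : forall f B, measurable B ->
    pv_meas f B = (inner (pv_proj B f) f)%:E ;
  pv_neg : forall f, pv_proj `]-oo, 0[ f = 0 %[ae mu] }.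

Implicit Types (E : spectral_family) (Psi : R -> R).

(* the operator int s(lambda) dE(lambda) for a simple function s *)
Definition spectral_sint E (s : {sfun R >-> R}) f : L2 mu :=
  \sum_(y \in range s) y *: E (s @^-1` [set y]) f.

Definition calculus_dom E Psi f : Prop :=
  (\int[pv_meas E f]_(l in `[0%R, +oo[) ((Psi l) ^+ 2)%:E < +oo)%E.

(* int Psi(lambda) dE(lambda) f is the L^2(mu)-limit of the integrals of simple
   functions converging to Psi in L^2(d(E(lambda) f, f)). *)
Definition calculus_graph E Psi f h : Prop :=
  calculus_dom E Psi f /\
  exists s : {sfun R >-> R}^nat,
    (\int[pv_meas E f]_(l in `[0%R, +oo[) ((s n l - Psi l) ^+ 2)%:E)%E
      @[n --> \oo] --> 0%E /\
    cvgL2 \oo (fun n => spectral_sint E (s n) f) h.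

Definition calculus E Psi f : L2 mu := xget 0 [set h | calculus_graph E Psi f h].

(* E is the spectral resolution of A: A = int lambda dE(lambda), domains
   included. *)
Definition spectral_resolution E (T : R -> L2 mu -> L2 mu) : Prop :=
  forall f h, generator_graph T f h <-> calculus_graph E id f h.

(* For f = 0 the left-hand side is 0, even if [Theta 0] is infinite, since
   [0 * Theta 0 = 0] in [\bar R]. *)
Definition nash_inequality (dom : L2 mu -> Prop) A (Theta : R -> \bar R) : Prop :=
  forall f, dom f -> (f : X -> R) \in Lfun mu 1 ->
    ('N[mu]_1[EFin \o f] <= 1)%E ->
    ((normsq f)%:E * Theta (normsq f) <= (inner (A f) f)%:E)%E.

End L2_operators.

Section rate_functions.
Context {R : realType}.
Implicit Types (D g beta : R -> R) (r s x : R).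

Definition nash_beta D r : \bar R :=
  ereal_sup [set (x - r * x * D x)%:E | x in `]0, +oo[].

(* only the restriction of g to ]0, +oo[ matters *)
Record bernstein g : Prop := {
  bernstein_gt0 : forall s, 0 < s -> 0 < g s ;
  bernstein_smooth : forall n s, 0 < s -> derivable (derive1n n g) s 1 ;
  bernstein_sign : forall n s, (1 <= n)%N -> 0 < s ->
    0 <= (-1) ^+ (n - 1) * derive1n n g s }.

Definition bernstein_at0 g : R := lim (g s @[s --> 0^'+]).

Definition bernstein_atoo g : \bar R := lim ((g s)%:E @[s --> +oo]).

(* the extension of g to [0, +oo[ by g(0) := g(0^+) *)
Definition bernstein_ext g s : R := if 0 < s then g s else bernstein_at0 g.

(* ['pinv_(fun=> 0) `]0, +oo[ g] is the inverse of the restriction of g to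
   ]0, +oo[; the conventions 1/0 = +oo and 1/+oo = 0 are those of [\bar R]. *)
Definition D_subordinate g beta x : \bar R :=
  ereal_sup [set (r^-1 - (r * x)^-1 * beta (('pinv_(fun=> 0) `]0, +oo[ g) r^-1)^-1)%:E
            | r in [set r | (bernstein_atoo g)^-1 < r%:E
                            < ((bernstein_at0 g)%:E)^-1]%E].

Definition D_compose g D x : \bar R :=
  ereal_sup [set ((1 - rho^-1) * bernstein_ext g (D (rho^-1 * x)))%:E
            | rho in `]1, +oo[].

End rate_functions.

(* Main.v *)
Require Import Defs.
From mathcomp Require Import all_boot all_order all_algebra.
From mathcomp Require Import all_classical all_reals all_analysis.
From mathcomp Require Import measurable_realfun ring lra.
Import Order.TTheory GRing.Theory Num.Theory.
Import numFieldTopology.Exports numFieldNormedType.Exports HBSimple.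
Set Implicit Arguments.
Unset Strict Implicit.
Unset Printing Implicit Defensive.
Local Open Scope classical_set_scope.
Local Open Scope ring_scope.

(** Write [m] for the spectral measure d(E(lambda) f, f), which has total mass
    [M = (f, f)], and [b = beta s^-1 >= 0] for [s > 0].  With [s = g^-1(1/r)],
    [M] times the term of index [r] in [D_subordinate g beta M] is
    [g s * (M - b)], so that part (i) says
      [int g dm >= g s * (M - b)] for every [s > 0].          ([*])
    This is [nash_bernstein_bound]; it rests on three facts.

    The Nash inequality for [A] is first linearised: by the definition of
    [beta] it gives [s * ((v, v) - b) <= (A v, v)] whenever the L^1-norm of [v]
    is at most 1 ([super_poincare]).  This is applied to the iterates of [f]
    under the resolvent [J = (1 + t A)^-1]: if [v = J u], then
    [(u, u) >= (v, v) + 2 t (A v, v)], hence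
    [(u, u) - b >= (1 + 2 t s) ((v, v) - b)].  As [J] contracts L^1, induction
    yields [int X^j dm <= b + y^j (M - b)] for all [j], where
    [X(lambda) = (1 + t lambda)^-2] and [y = (1 + 2 t s)^-1]
    ([resolvent_decay]).  Resolvents are used, rather than the semigroup, because
    the spectral resolution is related to [T] only through the generator; their
    L^1-contractivity comes from that of [T t], since [(1 + s (1 - T t) / t)^-1],
    which tends to [(1 + s A)^-1] as [t -> 0], is a Neumann series of powers of
    [T t] with positive coefficients of sum 1 ([resolvent_L1]).

    The passage from the powers of [X] to [g] is a Taylor expansion.  At
    [w = 0] the function [w |-> g (a - k w)] has nonpositive Taylor coefficients
    of order at least 1, and the remainder of order [n], divided by [w ^ n], is
    monotone; hence for [k < a] this function is on [0, 1] a uniform limit of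
    nonnegative constants plus nonnegative combinations of the functions
    [1 - w ^ j].  So, if [M >= b] (otherwise [*] is clear), the moment bounds give
    [int g (a - k X) dm >= (M - b) * g (a - k y)] ([bernstein_moment_le]).

    Finally, with [k = (2 t)^-1] and [a = k + e] one has
    [a - k X(lambda) <= e + lambda], and [t] can be chosen so that
    [a - k y = s] exactly.  Concavity bounds [g (e + lambda)] by
    [g lambda + g e - g (0+)], and [e -> 0] gives ([*]).

    That [(g(A) f, f) = int g dm], and that [J] exists, follows from the
    isometry between L^2(m) and L^2(mu) defined on simple functions and from the
    completeness of L^2(mu) ([spectral_value_exists], [spectral_value_dot]).

    In part (ii), [D_subordinate g beta x <= g (D x)] because
    [1 - beta s^-1 / x <= min 1 (D x / s)] and [g] is concave with
    [g (0+) >= 0]; the other inequality comes from the single index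
    [s = D (x / rho)], for which [beta s^-1 <= x / rho]. *)

(** * Square-integrable functions *)

Lemma cvg0_norm_le (R : realType) I (F : set_system I) {FF : Filter F}
    (u v : I -> R) :
  (forall i, `|u i| <= v i) -> v @ F --> (0 : R) -> u @ F --> (0 : R).
Proof.
move=> uv v0.
have nv0 : - v i @[i --> F] --> (0 : R) by rewrite -oppr0; exact: cvgN.
by apply: (squeeze_cvgr _ nv0 v0); apply: nearW => i; rewrite -ler_norml.
Qed.

Lemma limn_einf_le (R : realType) (u : (\bar R)^nat) (e : \bar R) K :
  (forall k, (K <= k)%N -> (u k <= e)%E) -> (limn_einf u <= e)%E.
Proof.
move=> ue; rewrite limn_einf_lim; apply: lime_le; first exact: is_cvg_einfs.
apply: nearW => n; apply: (@le_trans _ _ (u (n + K)%N)).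
  by apply: ereal_inf_lbound; exists (n + K)%N => //=; rewrite leq_addr.
by apply: ue; rewrite leq_addl.
Qed.

Section square_integrable.
Context d (T : measurableType d) (R : realType) (mu : {measure set T -> \bar R}).
Implicit Types f g h : T -> R.

(** The form [inner], for functions that are not packaged as elements of L^2:
    the same theory then serves L^2(mu) and L^2 of the spectral measures. *)
Definition dot f g : R := \int[mu]_x (f x * g x).

Lemma Lfun_measurable p f : f \in Lfun mu p -> measurable_fun setT f.
Proof. by rewrite inE => /andP[]; rewrite inE. Qed.

Lemma powR2 (x : R) : `|x| `^ 2 = x ^+ 2.
Proof. by rewrite powR_mulrn// real_normK// num_real. Qed.

Lemma Lfun2P f : measurable_fun setT f ->
  (\int[mu]_x (f x ^+ 2)%:E < +oo)%E -> f \in Lfun mu 2%:E.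
Proof.
move=> mf fi; rewrite inE; apply/andP; rewrite !inE; split => //=.
rewrite /finite_norm unlock poweR_lty//.
by under eq_integral do rewrite /= powR2.
Qed.

Lemma Lfun2D f g : f \in Lfun mu 2%:E -> g \in Lfun mu 2%:E ->
  f \+ g \in Lfun mu 2%:E.
Proof. exact: (Lfun_addr_closed mu (lee1n 2)).2. Qed.

Lemma Lfun2Z a f : f \in Lfun mu 2%:E -> (fun x => a * f x) \in Lfun mu 2%:E.
Proof.
move=> f2; have := Lfun_scale a (ler1n _ 2) f2.
by rewrite (_ : (fun x => a * f x) = a \o* f)//; apply/funext => x /=; rewrite mulrC.
Qed.

Lemma Lfun2B f g : f \in Lfun mu 2%:E -> g \in Lfun mu 2%:E ->
  f \- g \in Lfun mu 2%:E.
Proof.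
move=> f2 g2; rewrite (_ : f \- g = f \+ (fun x => -1 * g x)).
  by apply: Lfun2D => //; exact: Lfun2Z.
by apply/funext => x /=; rewrite mulN1r.
Qed.

Lemma dot_integrable f g : f \in Lfun mu 2%:E -> g \in Lfun mu 2%:E ->
  mu.-integrable setT (EFin \o (fun x => f x * g x)).
Proof. by move=> f2 g2; apply/Lfun1_integrable; exact: Lfun2_mul_Lfun1. Qed.

Lemma dotE f g : f \in Lfun mu 2%:E -> g \in Lfun mu 2%:E ->
  (dot f g)%:E = (\int[mu]_x (f x * g x)%:E)%E.
Proof.
move=> f2 g2; rewrite /dot /Rintegral fineK//.
exact: integrable_fin_num (dot_integrable f2 g2).
Qed.

Lemma dotC f g : dot f g = dot g f.
Proof. by apply: eq_Rintegral => x _; rewrite mulrC. Qed.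

Lemma dotDl f g h : f \in Lfun mu 2%:E -> g \in Lfun mu 2%:E ->
  h \in Lfun mu 2%:E -> dot (f \+ g) h = dot f h + dot g h.
Proof.
move=> f2 g2 h2; rewrite /dot -RintegralD//; try exact: dot_integrable.
by apply: eq_Rintegral => x _ /=; rewrite mulrDl.
Qed.

Lemma dotZl a f h : f \in Lfun mu 2%:E -> h \in Lfun mu 2%:E ->
  dot (fun x => a * f x) h = a * dot f h.
Proof.
move=> f2 h2; rewrite /dot -RintegralZl//; try exact: dot_integrable.
by apply: eq_Rintegral => x _ /=; rewrite mulrA.
Qed.

Lemma dotBl f g h : f \in Lfun mu 2%:E -> g \in Lfun mu 2%:E ->
  h \in Lfun mu 2%:E -> dot (f \- g) h = dot f h - dot g h.
Proof.
move=> f2 g2 h2; rewrite /dot -RintegralB//; try exact: dot_integrable.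
by apply: eq_Rintegral => x _ /=; rewrite mulrBl.
Qed.

Lemma dot_ge0 f : 0 <= dot f f.
Proof. by apply: Rintegral_ge0 => x _; rewrite -expr2 sqr_ge0. Qed.

Lemma dotBB f g : f \in Lfun mu 2%:E -> g \in Lfun mu 2%:E ->
  dot (f \- g) (f \- g) = dot f f - 2 * dot f g + dot g g.
Proof.
move=> f2 g2; have fg2 := Lfun2B f2 g2.
rewrite dotBl// (dotC f (_ \- _)) (dotC g (_ \- _)) !dotBl// (dotC g f); lra.
Qed.

Lemma dotDD f g : f \in Lfun mu 2%:E -> g \in Lfun mu 2%:E ->
  dot (f \+ g) (f \+ g) = dot f f + 2 * dot f g + dot g g.
Proof.
move=> f2 g2; have fg2 := Lfun2D f2 g2.
rewrite dotDl// (dotC f (_ \+ _)) (dotC g (_ \+ _)) !dotDl// (dotC g f); lra.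
Qed.

Lemma dotZZ a f : f \in Lfun mu 2%:E ->
  dot (fun x => a * f x) (fun x => a * f x) = a ^+ 2 * dot f f.
Proof. by move=> f2; rewrite dotZl ?Lfun2Z// dotC dotZl ?Lfun2Z//; ring. Qed.

Lemma cauchy_schwarz f g : f \in Lfun mu 2%:E -> g \in Lfun mu 2%:E ->
  dot f g ^+ 2 <= dot f f * dot g g.
Proof.
move=> f2 g2.
have key t : 0 <= dot f f - 2 * (t * dot f g) + t ^+ 2 * dot g g.
  have tg2 := Lfun2Z t g2; have := dot_ge0 (f \- (fun x => t * g x)).
  have e h : h \in Lfun mu 2%:E -> dot h (fun x => t * g x) = t * dot h g.
    by move=> h2; rewrite dotC dotZl// dotC.
  by rewrite dotBB// !e// dotZl// expr2 -mulrA.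
have [g0|g0] := eqVneq (dot g g) 0.
  have [->|fg0] := eqVneq (dot f g) 0; first by rewrite expr0n mulr_ge0 ?dot_ge0.
  have := key ((dot f f + 1) / dot f g).
  rewrite g0 mulr0 addr0 divfK// => h.
  by have := dot_ge0 f; lra.
have gp : 0 < dot g g by rewrite lt_neqAle eq_sym g0 dot_ge0.
have := key (dot f g / dot g g).
have -> : dot f f - 2 * (dot f g / dot g g * dot f g) + (dot f g / dot g g) ^+ 2 * dot g g
  = (dot f f * dot g g - dot f g ^+ 2) / dot g g by field.
by rewrite pmulr_lge0 ?invr_gt0// subr_ge0.
Qed.

Lemma normr_dot f g : f \in Lfun mu 2%:E -> g \in Lfun mu 2%:E ->
  `|dot f g| <= Num.sqrt (dot f f) * Num.sqrt (dot g g).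
Proof.
move=> f2 g2; rewrite -sqrtrM ?dot_ge0// -sqrtr_sqr ler_wsqrtr//.
exact: cauchy_schwarz.
Qed.

Lemma cvg_dot I (F : set_system I) {FF : Filter F} (u : I -> T -> R) h g :
  (forall i, u i \in Lfun mu 2%:E) -> h \in Lfun mu 2%:E -> g \in Lfun mu 2%:E ->
  dot (u i \- h) (u i \- h) @[i --> F] --> (0 : R) ->
  dot (u i) g @[i --> F] --> dot h g.
Proof.
move=> u2 h2 g2 uh; apply/subr_cvg0.
have s0 : Num.sqrt (dot (u i \- h) (u i \- h)) * Num.sqrt (dot g g)
    @[i --> F] --> (0 : R).
  rewrite -(mul0r (Num.sqrt (dot g g))) -sqrtr0; apply: cvgMr_tmp.
  apply: (@continuous_cvg _ _ _ _ _ (fun i => dot (u i \- h) (u i \- h))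
    (@Num.sqrt R) 0) => //.
  exact: sqrt_continuous.
apply: (cvg0_norm_le _ s0) => i; rewrite -dotBl//.
by apply: normr_dot => //; exact: Lfun2B.
Qed.

(** Fatou reduces the completeness of L^2 to almost everywhere convergence of
    a subsequence; for increments [w_ k] with squared norm at most [8^-k] the
    latter holds because [\sum_k 4^k (w_ k)^2] is integrable, hence finite
    almost everywhere, so that [w_ k] is O([2^-k]) there. *)
Lemma ae_cvg_of_fast_increments (v : nat -> T -> R) :
  (forall k, v k \in Lfun mu 2%:E) ->
  (forall k, dot (v k.+1 \- v k) (v k.+1 \- v k) <= 8^-1 ^+ k) ->
  \forall x \ae mu, cvgn (v ^~ x).
Proof.
move=> v2 fast; pose w k := v k.+1 \- v k.
have w2 k : w k \in Lfun mu 2%:E by exact: Lfun2B.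
pose W k x := (4 ^+ k * w k x ^+ 2)%:E : \bar R.
have W0 k x : (0 <= W k x)%E by rewrite /W lee_fin mulr_ge0 ?sqr_ge0 ?exprn_ge0.
have mW k : measurable_fun setT (W k).
  apply/measurable_EFinP; apply: measurable_funM => //.
  by apply: measurable_funX; exact: Lfun_measurable (w2 k).
have iW : (\int[mu]_x (\sum_(0 <= k <oo) W k x) < +oo)%E.
  rewrite integral_nneseries//.
  apply: (@le_lt_trans _ _ (\sum_(0 <= k <oo) (geometric 1 (2^-1 : R) k)%:E)%E).
    apply: lee_nneseries => k _; first by move=> _; exact: integral_ge0.
    rewrite /W; under eq_integral do rewrite EFinM.
    rewrite ge0_integralZl//; last 2 first.
    - by apply/measurable_EFinP/measurable_funX; exact: Lfun_measurable (w2 k).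
    - by move=> x _; rewrite lee_fin sqr_ge0.
    under eq_integral do rewrite expr2.
    rewrite -dotE// -EFinM lee_fin /= mul1r.
    apply: (@le_trans _ _ (4 ^+ k * 8^-1 ^+ k)).
      by rewrite ler_wpM2l ?exprn_ge0//; exact: fast.
    by rewrite -exprMn; rewrite (_ : 4 * 8^-1 = 2^-1 :> R)//; lra.
  have := @is_cvg_geometric_series R 1 2^-1.
  rewrite ger0_norm// invf_lt1// => /(_ (ltr1n _ 2)) cg.
  have -> : (\sum_(0 <= k <oo) (geometric 1 (2^-1 : R) k)%:E)%E
      = (limn (series (geometric 1 (2^-1 : R))))%:E.
    rewrite -EFin_lim//; congr (limn _); apply/funext => n /=.
    by rewrite /series /= sumEFin.
  exact: ltry.
have : mu.-integrable setT (fun x => (\sum_(0 <= k <oo) W k x)%E).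
  apply/integrableP; split.
    by apply: ge0_emeasurable_sum => //.
  by under eq_integral do rewrite gee0_abs ?nneseries_ge0//.
move/(integrable_ae measurableT); apply: filterS => x /(_ I).
set S := (\sum_(0 <= k <oo) W k x)%E => Sfin.
have bnd k : `|w k x| <= geometric (Num.sqrt (fine S)) 2^-1 k.
  have : (W k x <= S)%E.
    apply: le_trans (nneseries_lim_ge k.+1 _) => //.
    rewrite big_nat_recr//= leeDr// sume_ge0//.
  rewrite -(fineK Sfin) lee_fin => wS.
  rewrite /= exprVn ler_pdivlMr ?exprn_gt0//.
  rewrite -(ger0_norm (exprn_ge0 k (ler0n R 2))) -normrM -sqrtr_sqr.
  rewrite ler_wsqrtr// exprMn mulrC -exprM mulnC exprM.
  by rewrite (_ : 2 ^+ 2 = 4 :> R)//; lra.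
have cw : cvgn (series (w ^~ x)).
  apply: normed_cvg; apply: series_le_cvg bnd _ => //.
    by move=> n; rewrite mulr_ge0 ?sqrtr_ge0 ?exprn_ge0.
  by apply: is_cvg_geometric_series; rewrite ger0_norm ?invf_lt1 ?ltr1n.
have -> : v ^~ x = series (w ^~ x) \+ cst (v 0%N x).
  by apply/funext => n; rewrite /series /= /w /= telescope_sumr//; lra.
by apply: is_cvgD => //; exact: is_cvg_cst.
Qed.

(** The bound also provides the square-integrability of the limit [h]. *)
Lemma fatou_sqr_dist (v : nat -> T -> R) h f (e : R) K :
  (forall k, v k \in Lfun mu 2%:E) -> measurable_fun setT h ->
  (\forall x \ae mu, v k x @[k --> \oo] --> h x) -> f \in Lfun mu 2%:E ->
  (forall k, (K <= k)%N -> dot (v k \- f) (v k \- f) <= e) ->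
  (\int[mu]_x ((h x - f x) ^+ 2)%:E <= e%:E)%E.
Proof.
move=> v2 mh vh f2 ve.
have mvf k : measurable_fun setT (fun x => ((v k x - f x) ^+ 2)%:E).
  apply/measurable_EFinP/measurable_funX.
  exact: Lfun_measurable (Lfun2B (v2 k) f2).
have mhf : measurable_fun setT (fun x => ((h x - f x) ^+ 2)%:E).
  apply/measurable_EFinP/measurable_funX/measurable_funB => //.
  exact: Lfun_measurable f2.
rewrite (ae_eq_integral (fun x => limn_einf (fun k => ((v k x - f x) ^+ 2)%:E))) //.
- apply: le_trans (fatou mu measurableT mvf _) _.
    by move=> n x _; rewrite lee_fin sqr_ge0.
  apply: (@limn_einf_le _ _ _ K) => k Kk.
  under eq_integral do rewrite expr2.
  by rewrite -dotE ?lee_fin ?ve//; exact: Lfun2B.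
- have -> : (fun x => limn_einf (fun k => ((v k x - f x) ^+ 2)%:E))
     = (-%E \o (fun x => limn_esup (fun k => - ((v k x - f x) ^+ 2)%:E)))%E.
    apply/funext => x /=; rewrite -limn_einfN; congr limn_einf.
    by apply/funext => k /=; rewrite opprK.
  apply: measurableT_comp => //.
  apply: measurable_fun_limn_esup => k; exact: measurableT_comp.
- apply: filterS vh => x vh _.
  apply/esym; apply: (cvg_limn_einf_sup _).1.
  apply: cvg_EFin; first exact: nearW.
  rewrite /comp /=.
  have c : v k x - f x @[k --> \oo] --> h x - f x.
    by apply: cvgB => //; exact: cvg_cst.
  by rewrite expr2; under eq_fun do rewrite expr2; exact: cvgM.
Qed.

Lemma Lfun2_complete (u : nat -> T -> R) :
  (forall k, u k \in Lfun mu 2%:E) ->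
  (forall e, 0 < e -> exists N, forall n m, (N <= n)%N -> (N <= m)%N ->
    dot (u n \- u m) (u n \- u m) <= e) ->
  exists2 h, h \in Lfun mu 2%:E & dot (u n \- h) (u n \- h) @[n --> \oo] --> (0 : R).
Proof.
move=> u2 uC.
have e8 k : 0 < 8^-1 ^+ k :> R by rewrite exprn_gt0// invr_gt0.
have /choice[N uN] := fun k => uC (8^-1 ^+ k) (e8 k).
(* The maximum makes [n_] monotone, and [+ k] makes it tend to infinity. *)
pose n_ k := (\max_(i < k.+1) N i + k)%N.
have Nn i k : (i <= k)%N -> (N i <= n_ k)%N.
  move=> ik; apply: (leq_trans _ (leq_addr _ _)).
  exact: (@leq_bigmax _ (fun i : 'I_k.+1 => N i) (Ordinal (ik : (i < k.+1)%N))).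
pose v k := u (n_ k).
have v2 k : v k \in Lfun mu 2%:E by exact: u2.
have vae : \forall x \ae mu, cvgn (v ^~ x).
  apply: (ae_cvg_of_fast_increments v2) => k; apply: uN; exact: Nn.
pose h x := fine (limn_esup (fun k => (v k x)%:E)).
have mh : measurable_fun setT h.
  apply: measurableT_comp; first exact: fine_measurable.
  apply: measurable_fun_limn_esup => k; apply/measurable_EFinP.
  exact: Lfun_measurable (v2 k).
have vh : \forall x \ae mu, v k x @[k --> \oo] --> h x.
  apply: filterS vae => x cx.
  have c : (v k x)%:E @[k --> \oo] --> (limn (v ^~ x))%:E.
    by apply: cvg_EFin; [exact: nearW|exact: cx].
  rewrite /h (_ : limn_esup _ = (limn (v ^~ x))%:E)//.
  exact: (cvg_limn_einf_sup c).2.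
have hu e : 0 < e -> exists M, forall n, (M <= n)%N ->
    (\int[mu]_x ((h x - u n x) ^+ 2)%:E <= e%:E)%E.
  move=> e0; have [M uM] := uC _ e0; exists M => n Mn.
  apply: (@fatou_sqr_dist v h (u n) e M) => // k Mk.
  by apply: uM => //; apply: (leq_trans Mk); exact: leq_addl.
have hu2 e n : (\int[mu]_x ((h x - u n x) ^+ 2)%:E <= e%:E)%E ->
    h \- u n \in Lfun mu 2%:E.
  move=> le; apply: Lfun2P.
    by apply: measurable_funB => //; exact: Lfun_measurable (u2 n).
  exact: le_lt_trans le (ltry _).
have h2 : h \in Lfun mu 2%:E.
  have [M /(_ M (leqnn _)) /hu2 huM] := hu 1 ltr01.
  rewrite (_ : h = (h \- u M) \+ u M); first exact: Lfun2D.
  by apply/funext => x /=; rewrite subrK.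
exists h => //; apply/cvgrPdist_le => e e0.
have [M hM] := hu e e0; near=> n.
rewrite sub0r normrN ger0_norm ?dot_ge0// -lee_fin dotE; try exact: Lfun2B.
have Mn : (M <= n)%N by near: n; exists M.
apply: le_trans (hM n Mn); rewrite le_eqVlt; apply/orP; left; apply/eqP.
by apply: eq_integral => x _; congr EFin => /=; ring.
Unshelve. all: by end_near. Qed.

(** A bound on the L^1-norm passes to limits in L^2: on the sets
    [{ |f| >= 1 / n.+1 }], which exhaust [{ f != 0 }] and whose indicators are
    in L^2, the Cauchy-Schwarz inequality controls the L^1-distance by the
    L^2-distance. *)
Lemma integral_norm_le_of_L2_approx f (K : \bar R) :
  f \in Lfun mu 2%:E ->
  (forall e, 0 < e -> exists p, [/\ p \in Lfun mu 2%:E,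
    (\int[mu]_x (`|p x|)%:E <= K)%E & dot (f \- p) (f \- p) <= e]) ->
  (\int[mu]_x (`|f x|)%:E <= K)%E.
Proof.
move=> f2 fp.
have mf := Lfun_measurable f2.
pose F n := [set x | n.+1%:R^-1 <= `|f x|].
have mF n : measurable (F n).
  rewrite -[F n]setTI; apply: (measurable_fun_ler (f := cst n.+1%:R^-1)) => //.
  exact: measurableT_comp.
have F2 n : \1_(F n) \in Lfun mu 2%:E.
  apply: Lfun2P => //.
  apply: (@le_lt_trans _ _ (\int[mu]_x ((n.+1%:R * f x) ^+ 2)%:E)%E).
    apply: ge0_le_integral => //.
    - by apply/measurable_EFinP/measurable_funX.
    - by apply/measurable_EFinP/measurable_funX/measurable_funM.
    - move=> x _; rewrite lee_fin indicE.
      case: (boolP (x \in F n)) => [/set_mem/= Fx|_]; last by rewrite expr0n sqr_ge0.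
      rewrite expr1n -[leRHS]real_normK ?num_real// exprn_ege1// normrM normr_nat.
      by rewrite mulrC -ler_pdivrMr// div1r.
  under eq_integral do rewrite expr2.
  by rewrite -dotE ?ltry//; exact: Lfun2Z.
have ->: (\int[mu]_x (`|f x|)%:E = \int[mu]_(x in \bigcup_n F n) (`|f x|)%:E)%E.
  rewrite [RHS]integral_mkcond; apply: eq_integral => x _; rewrite patchE.
  case: ifPn => // /negP nF; have [->|fx0] := eqVneq (f x) 0; first by rewrite normr0.
  exfalso; apply: nF; apply/mem_set; exists (Num.truncn (`|f x|^-1)) => //=.
  rewrite /F /= -[leRHS]invrK lef_pV2 ?posrE ?invr_gt0 ?normr_gt0//.
  by apply/ltW/truncnS_gt.
have mnf : measurable_fun setT (fun x => (`|f x|)%:E).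
  by apply/measurable_EFinP; exact: measurableT_comp.
have c := @ge0_nondecreasing_set_cvg_integral _ _ _ F (fun x => (`|f x|)%:E) mu.
apply: (cvge_le _ (c _ _ _ _)) => //.
- apply: nearW => n; apply/lee_addgt0Pr => e e0.
  pose s := Num.sqrt (dot \1_(F n) \1_(F n)).
  have s0 : 0 <= s by exact: sqrtr_ge0.
  have es0 : 0 < (e / (s + 1)) ^+ 2 by rewrite exprn_gt0// divr_gt0// ltr_wpDl.
  have [p [p2 pK pe]] := fp _ es0.
  pose q := Num.norm \o (f \- p).
  have fp2 : f \- p \in Lfun mu 2%:E by exact: Lfun2B.
  have q2 : q \in Lfun mu 2%:E.
    apply: Lfun2P; first by apply: measurableT_comp => //; exact: Lfun_measurable fp2.
    rewrite (eq_integral (fun x => ((f \- p) x * (f \- p) x)%:E)).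
      by rewrite -dotE// ltry.
    by move=> x _; rewrite /q /= real_normK ?num_real// expr2.
  have mp := Lfun_measurable p2; have mq := Lfun_measurable q2.
  have mi : measurable_fun setT (\1_(F n) : T -> R) by [].
  rewrite integral_mkcond.
  apply: (@le_trans _ _ (\int[mu]_x ((`|p x|)%:E + (q x * \1_(F n) x)%:E))%E).
    apply: ge0_le_integral => //.
    - by move=> x _; rewrite patchE; case: ifP.
    - by apply/(measurable_restrictT _ (mF n))/measurable_funTS.
    - apply: emeasurable_funD; apply/measurable_EFinP; first exact: measurableT_comp.
      exact: measurable_funM.
    - move=> x _; rewrite patchE indicE; case: ifPn => _.
        rewrite -EFinD lee_fin mulr1 /q /= addrC -{1}(subrK (p x) (f x)).
        exact: ler_normD.
      by rewrite mulr0 adde0 lee_fin.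
  rewrite ge0_integralD//; last 3 first.
  - by apply/measurable_EFinP; exact: measurableT_comp.
  - by move=> x _; rewrite lee_fin mulr_ge0// /q /=.
  - by apply/measurable_EFinP; exact: measurable_funM.
  rewrite leeD// -dotE// lee_fin.
  apply: (le_trans (ler_norm _)); apply: (le_trans (normr_dot q2 (F2 n))).
  have -> : dot q q = dot (f \- p) (f \- p).
    by apply: eq_Rintegral => x _; rewrite /q /= -expr2 real_normK ?num_real.
  (* [s + 1] instead of [s], which may vanish. *)
  apply: (@le_trans _ _ (e / (s + 1) * s)).
    rewrite ler_wpM2r// -[leRHS]ger0_norm ?divr_ge0 ?addr_ge0 ?(ltW e0)//.
    by rewrite -sqrtr_sqr ler_wsqrtr.
  rewrite -mulrA ler_piMr ?(ltW e0)// mulrC ler_pdivrMr ?mul1r ?ltr_wpDl//.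
  by rewrite lerDl.
- move=> m n mn; apply/subsetPset => x /=; apply: le_trans.
  by rewrite lef_pV2 ?posrE// ler_nat ltnS.
- by move=> i; exact: measurable_funTS.
Qed.

Import HBNNSimple.
Lemma sfun_approx f : (forall x, 0 <= f x) -> f \in Lfun mu 2%:E ->
  exists s : {sfun T >-> R}^nat, (forall n, (s n : T -> R) \in Lfun mu 2%:E) /\
    dot (s n \- f) (s n \- f) @[n --> \oo] --> (0 : R).
Proof.
move=> f0 f2; have mf := Lfun_measurable f2.
have mfE : measurable_fun setT (EFin \o f) by apply/measurable_EFinP.
pose s : {sfun T >-> R}^nat := fun n => nnsfun_approx measurableT mfE n.
have s0 n x : 0 <= s n x by exact: fun_ge0.
have sf x : s n x @[n --> \oo] --> f x.
  have f0E y : [set: T] y -> (0 <= (EFin \o f) y)%E by rewrite lee_fin.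
  suff /fine_cvgP[] : (s n x)%:E @[n --> \oo] --> (f x)%:E by [].
  exact: (cvg_nnsfun_approx measurableT mfE f0E I).
have slef n x : s n x <= f x.
  have -> : s n x = approx setT (EFin \o f) n x.
    by rewrite -(nnsfun_approxE measurableT mfE).
  by rewrite -lee_fin; apply: le_approx => // y _; rewrite lee_fin.
have ms n : measurable_fun setT (s n) by exact: measurable_funPT.
have s2 n : (s n : T -> R) \in Lfun mu 2%:E.
  apply: Lfun2P => //; apply: (@le_lt_trans _ _ (\int[mu]_x (f x * f x)%:E)%E).
    apply: ge0_le_integral => //.
    - by move=> x _; rewrite lee_fin sqr_ge0.
    - by apply/measurable_EFinP/measurable_funX.
    - by apply/measurable_EFinP/measurable_funM.
    - by move=> x _; rewrite lee_fin expr2 ler_pM.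
  by rewrite -dotE ?ltry.
exists s; split => //.
have : (\int[mu]_x ((s n x - f x) * (s n x - f x))%:E)%E @[n --> \oo] --> (0 : \bar R).
  rewrite -(@integral0 _ _ _ mu setT).
  apply: (@dominated_cvg _ _ _ mu setT measurableT _ _ (fun x => (f x * f x)%:E)) => //.
  - move=> n; apply/measurable_EFinP; apply: measurable_funM; exact: measurable_funB.
  - move=> x _; apply: cvg_EFin; first exact: nearW.
    rewrite -(mulr0 0); rewrite -(subrr (f x)).
    by apply: cvgM; (apply: cvgB; [exact: sf|exact: cvg_cst]).
  - exact: dot_integrable.
  - move=> n x _; rewrite /= lee_fin normrM; have := slef n x; have := s0 n x => a b.
    have nle : `|s n x - f x| <= f x by rewrite ler0_norm; lra.
    by rewrite ler_pM.
have e n : (\int[mu]_x ((s n x - f x) * (s n x - f x))%:E)%E =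
    (dot (s n \- f) (s n \- f))%:E.
  by rewrite dotE//; exact: Lfun2B.
by under eq_fun do rewrite e; case/fine_cvgP.
Qed.
End square_integrable.

(** * The space L^2(mu) *)

Section L2_elements.
Context d (X : measurableType d) (R : realType) (mu : {measure set X -> \bar R}).
Implicit Types f g h : L2 mu.

Lemma Lnorm2E f : ('N[mu]_2%:E[EFin \o f] = (Num.sqrt (dot mu f f))%:E)%E.
Proof.
rewrite unlock -powR12_sqrt ?dot_ge0// -poweR_EFin dotE ?LfunP//.
by congr (_ `^ _)%E; apply: eq_integral => x _ /=; rewrite powR2 expr2.
Qed.

Lemma normsqE f : normsq f = dot mu f f.
Proof. by rewrite /normsq Lnorm2E /= sqr_sqrtr ?dot_ge0. Qed.

Lemma cvgL2P I (F : set_system I) {FF : Filter F} (u : I -> L2 mu) h :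
  cvgL2 F u h <-> dot mu (u i \- h) (u i \- h) @[i --> F] --> (0 : R).
Proof.
have uh i : (u i - h : L2 mu) = u i \- h :> (X -> R) by apply/funext.
rewrite /cvgL2; under eq_fun do rewrite Lnorm2E uh.
split => [/fine_cvgP[_] /= c|c].
  have -> : (fun i => dot mu (u i \- h) (u i \- h)) = (fun i =>
      Num.sqrt (dot mu (u i \- h) (u i \- h)) * Num.sqrt (dot mu (u i \- h) (u i \- h))).
    by apply/funext => i; rewrite -expr2 sqr_sqrtr ?dot_ge0.
  by rewrite -(mulr0 0); exact: cvgM.
apply: cvg_EFin; first exact: nearW.
rewrite -sqrtr0; apply: (@continuous_cvg _ _ _ _ _ _ (@Num.sqrt R)) => //.
exact: sqrt_continuous.
Qed.

(** Elements of L^2 are functions here, so the laws of operators, which hold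
    almost everywhere only, are used through this invariance. *)
Lemma dot_ae_eq (f f' g g' : L2 mu) : f = f' %[ae mu] -> g = g' %[ae mu] ->
  dot mu f g = dot mu f' g'.
Proof.
move=> ff' gg'; rewrite /dot /Rintegral; congr fine; apply: ae_eq_integral => //.
- by apply/measurable_EFinP/measurable_funM.
- by apply/measurable_EFinP/measurable_funM.
- by apply: filterS2 ff' gg' => x -> //; rewrite // => ->.
Qed.

Lemma L2_complete (u : nat -> L2 mu) :
  (forall e, 0 < e -> exists N, forall n m, (N <= n)%N -> (N <= m)%N ->
    dot mu (u n \- u m) (u n \- u m) <= e) ->
  exists h, cvgL2 \oo u h.
Proof.
move=> uC; have [h h2 uh] := Lfun2_complete (fun k => LfunP (u k)) uC.
by exists (Lfun_Sub (lee1n 2) h2); apply/cvgL2P.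
Qed.

Lemma dot_sum (S : eqType) (r : seq S) (F : S -> L2 mu) g :
  dot mu (\sum_(y <- r) F y : L2 mu) g = \sum_(y <- r) dot mu (F y) g.
Proof.
elim: r => [|y r IH].
  rewrite !big_nil; have -> : (0 : L2 mu) = (fun x => 0 * g x) :> (X -> R).
    by apply/funext => x; rewrite mul0r.
  by rewrite dotZl ?mul0r ?LfunP.
by rewrite !big_cons -IH -dotDl ?LfunP.
Qed.

End L2_elements.

(** * Integrals of simple functions and densities *)

Section simple_integrals.
Context d (T : measurableType d) (R : realType) (m : {measure set T -> \bar R}).

Lemma Lfun2_bounded (f : T -> R) c : (m setT < +oo)%E -> measurable_fun setT f ->
  (forall x, `|f x| <= c) -> f \in Lfun m 2%:E.
Proof.
move=> mfin mf fc; apply: Lfun2P => //.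
apply: (@le_lt_trans _ _ (\int[m]_x (c ^+ 2)%:E)%E).
  apply: ge0_le_integral => //.
  - by move=> x _; rewrite lee_fin sqr_ge0.
  - by apply/measurable_EFinP/measurable_funX.
  - move=> x _; rewrite lee_fin -real_normK ?num_real//.
    by rewrite lerXn2r ?nnegrE// (le_trans _ (fc x)).
by rewrite integral_cst//= lte_mul_pinfty// ?lee_fin ?sqr_ge0.
Qed.

Lemma Lfun2_indic (B : set T) : (m setT < +oo)%E -> measurable B ->
  (\1_B : T -> R) \in Lfun m 2%:E.
Proof.
move=> mfin mB; apply: (@Lfun2_bounded _ 1) => // x.
by rewrite indicE; case: (_ \in _); rewrite ?normr1 ?normr0.
Qed.

Lemma Lfun2_sfun (s : {sfun T >-> R}) : (m setT < +oo)%E ->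
  (s : T -> R) \in Lfun m 2%:E.
Proof.
move=> mfin; have [M [_ Ms]] := simple_bounded s.
apply: (@Lfun2_bounded _ (M + 1)) => // x.
by apply: Ms => //; rewrite ltrDl.
Qed.

Lemma Rintegral_sum (S : eqType) (r : seq S) (F : S -> T -> R) :
  (forall y, m.-integrable setT (EFin \o F y)) ->
  m.-integrable setT (EFin \o (fun x => \sum_(y <- r) F y x)) /\
  \int[m]_x (\sum_(y <- r) F y x) = \sum_(y <- r) \int[m]_x F y x.
Proof.
move=> Fi; elim: r => [|y r [IHi IH]].
  have -> : (fun x => \sum_(y <- [::]) F y x) = cst 0.
    by apply/funext => x; rewrite big_nil.
  split; first exact: integrable0.
  by rewrite big_nil Rintegral_cst// mul0r.
have e : (fun x => \sum_(z <- y :: r) F z x) = F y \+ (fun x => \sum_(z <- r) F z x).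
  by apply/funext => x; rewrite big_cons.
split; first by rewrite e; exact: (integrableD measurableT (Fi y) IHi).
by rewrite big_cons -IH -RintegralD//; apply: eq_Rintegral => x _; rewrite big_cons.
Qed.

Lemma Rintegral_sfunM (s : {sfun T >-> R}) (F : T -> R) :
  m.-integrable setT (EFin \o F) ->
  m.-integrable setT (EFin \o (s \* F)) /\
  \int[m]_x (s x * F x) =
  \sum_(y \in range s) y * \int[m]_x (\1_(s @^-1` [set y]) x * F x).
Proof.
move=> iF; pose r := finmap.enum_fset (fset_set (range s)).
have sE x : s x * F x = \sum_(y <- r) y * (\1_(s @^-1` [set y]) x * F x).
  rewrite fimfunE fsbig_finite// mulr_suml.
  by apply: eq_bigr => y _; rewrite mulrA.
have i1 y : m.-integrable setT (EFin \o (fun x => \1_(s @^-1` [set y]) x * F x)).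
  have -> : EFin \o (fun x => \1_(s @^-1` [set y]) x * F x) =
      (EFin \o F) \_ (s @^-1` [set y]).
    apply/funext => x; rewrite /= patchE indicE; case: ifP => _; by rewrite ?mul1r ?mul0r.
  apply/integrable_restrict => //; rewrite setTI; exact: integrableS iF.
have i2 y : m.-integrable setT (EFin \o (fun x => y * (\1_(s @^-1` [set y]) x * F x))).
  exact: (integrableZl measurableT y (i1 y)).
have [i3 e3] := Rintegral_sum r i2.
split.
  have -> : s \* F =
      (fun x => \sum_(y <- r) y * (\1_(s @^-1` [set y]) x * F x)).
    exact/funext.
  exact: i3.
under eq_Rintegral do rewrite sE.
rewrite e3 fsbig_finite//; apply: eq_bigr => y _.
by rewrite RintegralZl.
Qed.

End simple_integrals.

Section density.
Context d (T : measurableType d) (R : realType).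
Variables (m1 m2 : {measure set T -> \bar R}) (w : T -> R).
Hypothesis w0 : forall x, 0 <= w x.
Hypothesis iw : m1.-integrable setT (EFin \o w).
Hypothesis m2E : forall B, measurable B -> m2 B = (\int[m1]_x (\1_B x * w x))%:E.
Import HBNNSimple.

Lemma integral_density (F : T -> R) : (forall x, 0 <= F x) ->
  measurable_fun setT F ->
  (\int[m2]_x (F x)%:E = \int[m1]_x (F x * w x)%:E)%E.
Proof.
move=> F0 mF.
have mFE : measurable_fun setT (EFin \o F) by apply/measurable_EFinP.
have mw : measurable_fun setT w.
  by apply/measurable_EFinP; exact: (measurable_int m1).
pose s : {nnsfun T >-> R}^nat := nnsfun_approx measurableT mFE.
have F0E y : [set: T] y -> (0 <= (EFin \o F) y)%E by rewrite lee_fin.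
have sF x : (s n x)%:E @[n --> \oo] --> (F x)%:E.
  exact: (cvg_nnsfun_approx measurableT mFE F0E I).
have nd x a b : (a <= b)%N -> s a x <= s b x.
  by move=> ab; have /lefP := nd_nnsfun_approx measurableT mFE ab; exact.
have ms n : measurable_fun setT (s n) by exact: measurable_funPT.
have e n : (\int[m2]_x (s n x)%:E = \int[m1]_x (s n x * w x)%:E)%E.
  have [i1 e1] := Rintegral_sfunM (s n) iw.
  rewrite integralT_nnsfun sintegralE -[RHS]fineK; last exact: integrable_fin_num i1.
  rewrite [fine _]e1 !fsbig_finite// -sumEFin; apply: eq_bigr => y _.
  by rewrite m2E.
have c2 := @cvg_monotone_convergence _ _ _ m2 setT measurableT
  (fun n x => (s n x)%:E).
have c1 := @cvg_monotone_convergence _ _ _ m1 setT measurableT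
  (fun n x => (s n x * w x)%:E).
have l2 : (\int[m2]_x (s n x)%:E)%E @[n --> \oo] --> (\int[m2]_x (F x)%:E)%E.
  have -> : (\int[m2]_x (F x)%:E)%E = (\int[m2]_x limn (fun n => (s n x)%:E))%E.
    by apply: eq_integral => x _; apply/esym/cvg_lim => //; exact: sF.
  apply: c2 => //.
  - by move=> n; apply/measurable_EFinP.
  - by move=> n x _; rewrite lee_fin.
  - by move=> x _ a b ab; rewrite lee_fin nd.
have l1 : (\int[m1]_x (s n x * w x)%:E)%E @[n --> \oo] -->
    (\int[m1]_x (F x * w x)%:E)%E.
  have -> : (\int[m1]_x (F x * w x)%:E)%E =
      (\int[m1]_x limn (fun n => (s n x * w x)%:E))%E.
    apply: eq_integral => x _; apply/esym/cvg_lim => //.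
    apply: cvg_EFin; first exact: nearW.
    by have /fine_cvgP[_ c] := sF x; exact: cvgMr_tmp c.
  apply: c1 => //.
  - by move=> n; apply/measurable_EFinP/measurable_funM.
  - by move=> n x _; rewrite lee_fin mulr_ge0.
  - by move=> x _ a b ab; rewrite lee_fin ler_wpM2r// nd.
by move: l2; under eq_fun do rewrite e; move=> l2; apply: (cvg_unique _ l2 l1).
Qed.

End density.

(** * Functional calculus of the spectral resolution *)

Section spectral.
Context d (X : measurableType d) (R : realType) (mu : {measure set X -> \bar R}).
Variable E : spectral_family mu.
Implicit Types f g h : L2 mu.
Local Notation m := (pv_meas E).

Lemma dot_projl B f g : measurable B -> dot mu (E B f) g = dot mu f (E B g).
Proof. by move=> mB; exact: (pv_symmetric E f g mB). Qed.

Lemma dot_proj B C f g : measurable B -> measurable C ->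
  dot mu (E B f) (E C g) = dot mu (E (B `&` C) f) g.
Proof.
move=> mB mC; rewrite (dot_projl _ _ mB) [RHS]dot_projl; last exact: measurableI.
by apply/esym/dot_ae_eq; [exact: nearW|exact: pv_setI].
Qed.

Lemma pv_measE_dot f B : measurable B -> m f B = (dot mu (E B f) f)%:E.
Proof. exact: pv_measE. Qed.

Lemma pv_meas_setT f : m f setT = (dot mu f f)%:E.
Proof.
rewrite pv_measE_dot//; congr EFin; apply: dot_ae_eq; [exact: pv_setT|exact: nearW].
Qed.

Lemma pv_meas_fin f : (m f setT < +oo)%E.
Proof. by rewrite pv_meas_setT ltry. Qed.

Lemma pv_meas_neg f : m f [set` `]-oo, (0 : R)[] = 0%E.
Proof.
rewrite pv_measE_dot//; congr EFin.
rewrite (@dot_ae_eq _ _ _ mu _ (0 : L2 mu) f f); [|exact: pv_neg|exact: nearW].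
have -> : (0 : L2 mu) = (fun x => 0 * f x) :> (X -> R).
  by apply/funext => x; rewrite mul0r.
by rewrite dotZl ?LfunP ?mul0r.
Qed.

(** The spectral measures do not charge the negative half-line. *)
Lemma integral_pv_meas f (F : R -> \bar R) : measurable_fun setT F ->
  (forall x, (0 <= F x)%E) ->
  (\int[m f]_(l in `[0%R, +oo[) F l = \int[m f]_l F l)%E.
Proof.
move=> mF F0.
rewrite [RHS](@ge0_negligible_integral _ _ _ _ _ [set` `]-oo, (0 : R)[])//;
  last exact: pv_meas_neg.
congr (integral _ _ _); apply/seteqP; split => x /=; rewrite !in_itv/= andbT.
  by move=> x0; split => //; rewrite ltNge x0.
by move=> [_]; rewrite leNgt => /negP.
Qed.

Lemma dot_pv_indic f B C : measurable B -> measurable C ->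
  dot (m f) \1_B \1_C = dot mu (E B f) (E C f).
Proof.
move=> mB mC; rewrite dot_proj//.
have mBC := measurableI _ _ mB mC.
apply: EFin_inj; rewrite -pv_measE_dot// dotE; try exact: (Lfun2_indic (pv_meas_fin f)).
rewrite -[in RHS](setIT (B `&` C)) -integral_indic//.
by apply: eq_integral => x _; rewrite indicI.
Qed.

Lemma Lfun2_pv_integrable f (F : R -> R) :
  F \in Lfun (m f) 2%:E -> (m f).-integrable setT (EFin \o F).
Proof.
move=> F2.
have := dot_integrable F2 (Lfun2_indic (pv_meas_fin f) measurableT).
by apply: eq_integrable => // x _; rewrite /= indicT mulr1.
Qed.

Lemma dot_sint (s : {sfun R >-> R}) f g : dot mu (spectral_sint E s f) g =
  \sum_(y \in range s) y * dot mu (E (s @^-1` [set y]) f) g.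
Proof.
rewrite /spectral_sint fsbig_finite// dot_sum [RHS]fsbig_finite//.
by apply: eq_bigr => y _; rewrite -dotZl ?LfunP.
Qed.

Lemma dot_sfun f (s : {sfun R >-> R}) (F : R -> R) : F \in Lfun (m f) 2%:E ->
  dot (m f) s F = \sum_(y \in range s) y * dot (m f) \1_(s @^-1` [set y]) F.
Proof. by move=> F2; case: (Rintegral_sfunM s (Lfun2_pv_integrable F2)). Qed.

Lemma dot_sint_proj (s : {sfun R >-> R}) f B : measurable B ->
  dot mu (spectral_sint E s f) (E B f) = dot (m f) s \1_B.
Proof.
move=> mB; rewrite dot_sint dot_sfun; last exact: (Lfun2_indic (pv_meas_fin f)).
by apply: eq_fsbigr => y _; rewrite dot_pv_indic.
Qed.

(** The spectral integral is isometric on simple functions. Expanding over the two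
    ranges in turn avoids a common refinement of the two partitions. *)
Lemma dot_sint_sint (s t : {sfun R >-> R}) f :
  dot mu (spectral_sint E s f) (spectral_sint E t f) = dot (m f) s t.
Proof.
rewrite dotC dot_sint dotC dot_sfun; last exact: (Lfun2_sfun _ (pv_meas_fin f)).
by apply: eq_fsbigr => y _; rewrite dotC dot_sint_proj// dotC.
Qed.

(** [h] is the value of [Psi(A)] at [f]. In contrast with [calculus_graph], [Psi]
    is measurable on the whole line and the integrals are not restricted to
    [0, +oo[; see [calculus_graphP]. *)
Definition spectral_value Psi f h := Psi \in Lfun (m f) 2%:E /\
  exists s : {sfun R >-> R}^nat,
    dot (m f) (s n \- Psi) (s n \- Psi) @[n --> \oo] --> (0 : R) /\
    cvgL2 \oo (fun n => spectral_sint E (s n) f) h.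

Lemma calculus_domP (Psi0 Psi : R -> R) f : measurable_fun setT Psi ->
  (forall l, 0 <= l -> Psi0 l = Psi l) ->
  calculus_dom E Psi0 f <-> Psi \in Lfun (m f) 2%:E.
Proof.
move=> mPsi e; rewrite /calculus_dom.
rewrite (eq_integral (fun l => (Psi l ^+ 2)%:E)); last first.
  by move=> l; rewrite inE/= in_itv/= andbT => l0; rewrite e.
rewrite integral_pv_meas//; last 2 first.
- by apply/measurable_EFinP/measurable_funX.
- by move=> x; rewrite lee_fin sqr_ge0.
split => [|P2]; first exact: Lfun2P.
by under eq_integral do rewrite expr2; rewrite -dotE ?ltry.
Qed.

Lemma calculus_graphP (Psi0 Psi : R -> R) f h : measurable_fun setT Psi ->
  (forall l, 0 <= l -> Psi0 l = Psi l) ->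
  calculus_graph E Psi0 f h <-> spectral_value Psi f h.
Proof.
move=> mPsi e; rewrite /calculus_graph /spectral_value (calculus_domP f mPsi e).
have key (s : {sfun R >-> R}^nat) : Psi \in Lfun (m f) 2%:E ->
    (\int[m f]_(l in `[0%R, +oo[) ((s n l - Psi0 l) ^+ 2)%:E)%E @[n --> \oo] --> 0%E <->
    dot (m f) (s n \- Psi) (s n \- Psi) @[n --> \oo] --> (0 : R).
  move=> P2.
  have ee n : (\int[m f]_(l in `[0%R, +oo[) ((s n l - Psi0 l) ^+ 2)%:E)%E =
      (dot (m f) (s n \- Psi) (s n \- Psi))%:E.
    have sP2 : s n \- Psi \in Lfun (m f) 2%:E.
      by apply: Lfun2B => //; exact: (Lfun2_sfun _ (pv_meas_fin f)).
    rewrite (eq_integral (fun l => ((s n \- Psi) l * (s n \- Psi) l)%:E)); last first.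
      by move=> l; rewrite inE/= in_itv/= andbT => l0; rewrite /= e// expr2.
    rewrite integral_pv_meas ?dotE//.
      by apply/measurable_EFinP/measurable_funM; exact: Lfun_measurable sP2.
    by move=> x; rewrite lee_fin -expr2 sqr_ge0.
  under eq_fun do rewrite ee.
  split=> [/fine_cvgP[]//|c].
  by apply: cvg_EFin => //; exact: nearW.
by split=> -[P2 [s [c cc]]]; split => //; exists s; split => //; apply/key.
Qed.

Lemma spectral_value_exists Psi f : (forall l, 0 <= Psi l) ->
  Psi \in Lfun (m f) 2%:E ->
  exists h, spectral_value Psi f h.
Proof.
move=> P0 P2; have [s [s2 sP]] := sfun_approx P0 P2.
have [|h uh] := @L2_complete _ _ _ mu (fun n => spectral_sint E (s n) f); last first.
  by exists h; split => //; exists s.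
move=> e e0.
have iso n k : dot mu (spectral_sint E (s n) f \- spectral_sint E (s k) f)
    (spectral_sint E (s n) f \- spectral_sint E (s k) f) =
    dot (m f) (s n \- s k) (s n \- s k).
  by rewrite !dotBB ?LfunP ?s2// !dot_sint_sint.
have e4 : 0 < e / 4 by rewrite divr_gt0.
have /cvgrPdist_le/(_ _ e4) [N _ HN] := sP.
exists N => n k Nn Nk; rewrite iso.
have par (a b : R -> R) : a \in Lfun (m f) 2%:E -> b \in Lfun (m f) 2%:E ->
    dot (m f) (a \- b) (a \- b) <= 2 * dot (m f) a a + 2 * dot (m f) b b.
  move=> a2 b2; have := dot_ge0 (m f) (a \+ b); rewrite dotBB//.
  by rewrite dotDD//; lra.
have -> : s n \- s k = (s n \- Psi) \- (s k \- Psi) :> (R -> R).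
  by apply/funext => x /=; ring.
apply: le_trans (par _ _ (Lfun2B (s2 n) P2) (Lfun2B (s2 k) P2)) _.
have := HN n Nn; have := HN k Nk.
rewrite !sub0r !normrN !ger0_norm ?dot_ge0//; lra.
Qed.

Lemma spectral_value_dot_proj Psi f h B : spectral_value Psi f h -> measurable B ->
  dot mu h (E B f) = dot (m f) Psi \1_B.
Proof.
move=> [P2 [s [sP sh]]] mB.
have c1 : dot mu (spectral_sint E (s n) f) (E B f) @[n --> \oo] --> dot mu h (E B f).
  by apply: cvg_dot => //; [move=> n|..]; rewrite ?LfunP//; exact/cvgL2P.
move: c1; under eq_fun do rewrite dot_sint_proj//.
move=> c1; apply: (cvg_unique _ c1) => //.
apply: cvg_dot => //; first by move=> n; exact: (Lfun2_sfun _ (pv_meas_fin f)).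
exact: (Lfun2_indic (pv_meas_fin f)).
Qed.

Lemma spectral_value_dot Psi f h : spectral_value Psi f h ->
  dot mu h f = \int[m f]_l Psi l.
Proof.
move=> sp; have := spectral_value_dot_proj sp measurableT.
have -> : dot mu h (E setT f) = dot mu h f.
  by apply: dot_ae_eq; [exact: nearW|exact: pv_setT].
by move=> ->; apply: eq_Rintegral => x _; rewrite indicT mulr1.
Qed.

Lemma Lfun2_indicM f (F : R -> R) B : measurable B -> F \in Lfun (m f) 2%:E ->
  (fun l => F l * \1_B l) \in Lfun (m f) 2%:E.
Proof.
move=> mB F2; have mF := Lfun_measurable F2; apply: Lfun2P; first exact: measurable_funM.
apply: (@le_lt_trans _ _ (\int[m f]_x (F x * F x)%:E)%E).
  apply: ge0_le_integral => //.
  - by move=> x _; rewrite lee_fin sqr_ge0.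
  - by apply/measurable_EFinP/measurable_funX/measurable_funM.
  - by apply/measurable_EFinP/measurable_funM.
  - move=> x _; rewrite lee_fin indicE.
    case: (_ \in _); rewrite ?mulr1 ?expr2// mulr0 mul0r.
    by rewrite -expr2 sqr_ge0.
by rewrite -dotE// ltry.
Qed.

(** d(E(lambda) h, h) has density [Psi ^+ 2] with respect to
    d(E(lambda) f, f), as [E B] commutes with [Psi(A)]; this is the form in which
    values of the functional calculus are composed below. *)
Lemma spectral_value_pv_meas Psi f h : spectral_value Psi f h ->
  forall B, measurable B -> m h B = (\int[m f]_l (\1_B l * Psi l ^+ 2))%:E.
Proof.
move=> sp B mB; have [P2 [s [sP sh]]] := sp.
rewrite pv_measE_dot//; congr EFin.
have c1 : dot mu (spectral_sint E (s n) f) (E B h) @[n --> \oo] --> dot mu h (E B h).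
  by apply: cvg_dot => //; [move=> n|..]; rewrite ?LfunP//; exact/cvgL2P.
have PB2 := Lfun2_indicM mB P2.
have -> : \int[m f]_l (\1_B l * Psi l ^+ 2) = dot (m f) Psi (fun l => Psi l * \1_B l).
  by apply: eq_Rintegral => l _ /=; ring.
rewrite dotC.
have e n : dot mu (spectral_sint E (s n) f) (E B h) =
    dot (m f) (s n) (fun l => Psi l * \1_B l).
  rewrite dot_sint dot_sfun//; apply: eq_fsbigr => y _.
  rewrite dot_proj// dotC (spectral_value_dot_proj sp); last exact: measurableI.
  by congr (_ * _); apply: eq_Rintegral => l _; rewrite indicI /=; ring.
move: c1; under eq_fun do rewrite e.
move=> c1; apply: (cvg_unique _ c1) => //.
by apply: cvg_dot => // n; exact: (Lfun2_sfun _ (pv_meas_fin f)).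
Qed.

End spectral.

(** * Resolvents *)

Section resolvent.
Context d (X : measurableType d) (R : realType) (mu : {measure set X -> \bar R}).
Variable E : spectral_family mu.
Implicit Types f g h u v w : L2 mu.
Local Notation m := (pv_meas E).

Lemma spectral_value_integral Psi u v (F : R -> R) : spectral_value E Psi u v ->
  (forall l, 0 <= F l) -> measurable_fun setT F ->
  (\int[m v]_l (F l)%:E = \int[m u]_l (F l * Psi l ^+ 2)%:E)%E.
Proof.
move=> sp F0 mF; apply: integral_density => //.
- by move=> x; rewrite sqr_ge0.
- have := dot_integrable sp.1 sp.1.
  by apply: eq_integrable => // x _; rewrite /= expr2.
- exact: (spectral_value_pv_meas sp).
Qed.

Lemma spectral_value_Rintegral Psi u v (F : R -> R) : spectral_value E Psi u v ->
  (forall l, 0 <= F l) -> measurable_fun setT F ->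
  \int[m v]_l F l = \int[m u]_l (F l * Psi l ^+ 2).
Proof. by move=> sp F0 mF; rewrite /Rintegral (spectral_value_integral sp). Qed.

(** The identity of [0, +oo[, extended so as to be nonnegative on the line. *)
Definition pospart (l : R) : R := Num.max 0 l.
Definition resolvent_symbol (t l : R) : R := (1 + t * pospart l)^-1.

Lemma pospart_ge0 l : 0 <= pospart l.
Proof. by rewrite le_max lexx. Qed.

Lemma pospart_id l : 0 <= l -> pospart l = l.
Proof. by move=> l0; rewrite /pospart max_r. Qed.

Lemma measurable_pospart : measurable_fun setT pospart.
Proof. exact: measurable_maxr. Qed.

Lemma resolvent_den_ge1 t l : 0 < t -> 1 <= 1 + t * pospart l.
Proof. by move=> t0; rewrite lerDl mulr_ge0 ?pospart_ge0// ltW. Qed.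

Lemma resolvent_symbol_ge0 t l : 0 < t -> 0 <= resolvent_symbol t l.
Proof. by move=> t0; rewrite invr_ge0 (le_trans ler01)// resolvent_den_ge1. Qed.

Lemma resolvent_symbol_le1 t l : 0 < t -> resolvent_symbol t l <= 1.
Proof.
move=> t0; rewrite invf_le1 ?resolvent_den_ge1//.
by rewrite (lt_le_trans ltr01)// resolvent_den_ge1.
Qed.

Lemma normr_resolvent_symbol t l : 0 < t -> `|resolvent_symbol t l| <= 1.
Proof. by move=> t0; rewrite ger0_norm ?resolvent_symbol_ge0// resolvent_symbol_le1. Qed.

Lemma measurable_resolvent_symbol t : 0 < t -> measurable_fun setT (resolvent_symbol t).
Proof.
move=> t0; apply: continuous_measurable_fun => x.
apply: (@continuousV _ _ (fun l => 1 + t * pospart l)).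
  by rewrite gt_eqF// (lt_le_trans ltr01)// resolvent_den_ge1.
apply: cvgD; first exact: cvg_cst.
apply: cvgMl_tmp; apply: continuous_max; [exact: cvg_cst|exact: cvg_id].
Qed.

Lemma resolvent_symbolE t l : 0 < t ->
  1 - resolvent_symbol t l = t * (pospart l * resolvent_symbol t l).
Proof.
move=> t0; rewrite /resolvent_symbol; have := resolvent_den_ge1 l t0 => h.
field; rewrite gt_eqF//; lra.
Qed.

(** Both values are integrals against d(E(lambda) u, u): with [phi] the symbol
    of the resolvent, [v = phi(A) u], and d(E(lambda) v, v) has density
    [phi ^ 2]. The identity [1 - phi = t * lambda * phi] turns the distance from
    an approximation [spectral_sint E s v] of [A v] to [t^-1 (u - v)] into the
    distance from [s] to [lambda] in L^2(d(E(lambda) v, v)). *)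
Lemma resolvent_exists t u : 0 < t ->
  exists v, spectral_value E (resolvent_symbol t) u v /\
    spectral_value E pospart v (t^-1 *: (u - v)).
Proof.
move=> t0; pose phi := resolvent_symbol t.
have mphi : measurable_fun setT phi by exact: measurable_resolvent_symbol.
have phi2 : phi \in Lfun (m u) 2%:E.
  by apply: (Lfun2_bounded (pv_meas_fin E u) mphi) => l; exact: normr_resolvent_symbol.
have [v sp] := spectral_value_exists (fun l => resolvent_symbol_ge0 l t0) phi2.
exists v; split=> //; set w := _ *: _.
have uE : dot mu u u = \int[m u]_l 1.
  by rewrite Rintegral_cst// mul1r pv_meas_setT.
have vE : dot mu v v = \int[m u]_l (phi l * phi l).
  apply: EFin_inj; rewrite -(pv_meas_setT E) (spectral_value_pv_meas sp)//; congr EFin.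
  by apply: eq_Rintegral => l _; rewrite indicT mul1r expr2.
have uvE : dot mu u v = \int[m u]_l phi l by rewrite dotC (spectral_value_dot sp).
(* [psi] is the symbol of [u |-> t^-1 (u - v) = A v]. *)
pose psi l := t^-1 * (1 - phi l).
have psiE l : psi l = pospart l * phi l.
  by rewrite /psi resolvent_symbolE// mulrA mulVf ?gt_eqF// mul1r.
have psi2 : psi \in Lfun (m u) 2%:E.
  apply: (@Lfun2_bounded _ _ _ _ _ t^-1 (pv_meas_fin E u)).
    by apply: measurable_funM => //; exact: measurable_funB.
  move=> l; rewrite normrM ger0_norm ?invr_ge0 ?(ltW t0)// ler_piMr ?invr_ge0 ?(ltW t0)//.
  have := resolvent_symbol_ge0 l t0; have := resolvent_symbol_le1 l t0 => h1 h2.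
  by rewrite ger0_norm /phi; lra.
have wE g : dot mu w g = t^-1 * (dot mu u g - dot mu v g).
  by rewrite -dotBl ?LfunP// -dotZl ?Lfun2B ?LfunP.
have p2 : pospart \in Lfun (m v) 2%:E.
  apply: Lfun2P; first exact: measurable_pospart.
  rewrite (spectral_value_integral sp); last 2 first.
  - by move=> l; rewrite sqr_ge0.
  - by apply: measurable_funX; exact: measurable_pospart.
  rewrite (eq_integral (fun l => (psi l * psi l)%:E)); first by rewrite -dotE// ltry.
  by move=> l _; rewrite psiE; congr EFin; rewrite /phi; ring.
have [s [s2 sP]] := sfun_approx pospart_ge0 p2.
split => //; exists s; split => //; apply/cvgL2P.
suff e n : dot mu (spectral_sint E (s n) v \- w) (spectral_sint E (s n) v \- w) =
    dot (m v) (s n \- pospart) (s n \- pospart).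
  by under eq_fun do rewrite e.
rewrite !dotBB ?LfunP//; congr (_ - 2 * _ + _).
- exact: dot_sint_sint.
- rewrite dot_sint dot_sfun//; apply: eq_fsbigr => y _; congr (_ * _).
  set C := _ @^-1` _; have mC : measurable C by exact: measurable_sfunP.
  rewrite dotC wE -dot_projl// dotC (spectral_value_dot_proj sp)// -(dot_projl E)//.
  have -> : dot mu (E C v) v = dot (m u) phi (fun l => phi l * \1_C l).
    apply: EFin_inj; rewrite -pv_measE_dot// (spectral_value_pv_meas sp)//; congr EFin.
    by apply: eq_Rintegral => l _; rewrite /phi; ring.
  rewrite /dot (spectral_value_Rintegral sp); last 2 first.
  - by move=> l; rewrite mulr_ge0// pospart_ge0.
  - by apply: measurable_funM => //; exact: measurable_pospart.
  rewrite -RintegralB//; last 2 first.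
  - by apply: dot_integrable => //; exact: (Lfun2_indic (pv_meas_fin E u)).
  - by apply: dot_integrable => //; exact: Lfun2_indicM.
  have iphiC : (m u).-integrable setT
      (EFin \o (fun l => phi l * \1_C l - phi l * (phi l * \1_C l))).
    have ia := dot_integrable phi2 (Lfun2_indic (pv_meas_fin E u) mC).
    have ib := dot_integrable phi2 (Lfun2_indicM mC phi2).
    exact: (integrableB measurableT ia ib).
  rewrite -RintegralZl//; apply: eq_Rintegral => l _.
  rewrite (_ : t^-1 * _ = \1_C l * phi l * psi l); last by rewrite /psi /phi; ring.
  by rewrite psiE /phi; ring.
- rewrite wE dotC (dotC _ v) !wE vE uE uvE (dotC _ v u) uvE.
  rewrite [RHS](spectral_value_Rintegral sp); last 2 first.
  - by move=> l; rewrite mulr_ge0// pospart_ge0.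
  - by apply: measurable_funM; exact: measurable_pospart.
  rewrite [RHS](_ : _ = dot (m u) psi psi); last first.
    by apply: eq_Rintegral => l _; rewrite psiE /phi; ring.
  have one2 : (fun _ => 1) \in Lfun (m u) 2%:E.
    by apply: (@Lfun2_bounded _ _ _ _ _ 1 (pv_meas_fin E u)) => // x; rewrite normr1.
  have -> : psi = (fun l => t^-1 * ((fun _ => 1) \- phi) l) by [].
  rewrite dotZl ?Lfun2Z ?Lfun2B// dotC dotZl ?Lfun2B// dotBB//.
  rewrite (_ : dot (m u) (fun=> 1) (fun=> 1) = \int[m u]_l 1); last first.
    by apply: eq_Rintegral => l _; rewrite mulr1.
  rewrite (_ : dot (m u) (fun=> 1) phi = \int[m u]_l phi l); last first.
    by apply: eq_Rintegral => l _; rewrite mul1r.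
  rewrite /dot; ring.
Qed.

End resolvent.

(** * Resolvents are contractions of L^1 *)

Section semigroup_resolvent.
Context d (X : measurableType d) (R : realType) (mu : {measure set X -> \bar R}).
Variable T : R -> L2 mu -> L2 mu.
Hypothesis sgT : contraction_semigroup T.
Implicit Types f g h u v w p : L2 mu.

Lemma Lfun1P f : ('N[mu]_1[EFin \o f] < +oo)%E -> (f : X -> R) \in Lfun mu 1.
Proof.
move=> fi; rewrite inE; apply/andP; rewrite !inE; split => //=.
Qed.

Lemma Lfun1_fin f : (f : X -> R) \in Lfun mu 1 -> ('N[mu]_1[EFin \o f] < +oo)%E.
Proof. by rewrite inE => /andP[_]; rewrite inE. Qed.

Lemma dot_contraction t f : 0 < t -> dot mu (T t f) (T t f) <= dot mu f f.
Proof.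
move=> t0; have := sg_contraction2 sgT f t0.
by rewrite !Lnorm2E lee_fin ler_sqrt ?dot_ge0.
Qed.

Lemma dot_convex (q : R) (a b : X -> R) : 0 <= q -> q <= 1 ->
  a \in Lfun mu 2%:E -> b \in Lfun mu 2%:E ->
  dot mu (fun x => q * a x + (1 - q) * b x) (fun x => q * a x + (1 - q) * b x)
  <= q * dot mu a a + (1 - q) * dot mu b b.
Proof.
move=> q0 q1 a2 b2.
rewrite dotDD ?Lfun2Z// !dotZZ// dotZl ?Lfun2Z// dotC dotZl// (dotC _ b a).
have := dot_ge0 mu (a \- b); rewrite dotBB// => h.
rewrite -subr_ge0 (_ : _ - _ = q * (1 - q) * (dot mu a a - 2 * dot mu a b + dot mu b b)).
  by rewrite mulr_ge0// mulr_ge0// subr_ge0.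
ring.
Qed.

(** The solution of [p = q u + (1 - q) T_t p], with [q = t / (t + s)], is the
    image of [u] by the resolvent [(1 + s (1 - T_t) / t)^-1]; [neumann] lists the
    iterates converging to it, whose L^1-norms the contractivity of [T_t]
    keeps below that of [u]. *)
Fixpoint neumann (t q : R) u (n : nat) : L2 mu :=
  if n is k.+1 then q *: u + (1 - q) *: T t (neumann t q u k) else 0.

Lemma neumann_L1 t q u n : 0 < t -> 0 <= q -> q <= 1 -> (u : X -> R) \in Lfun mu 1 ->
  ('N[mu]_1[EFin \o neumann t q u n] <= 'N[mu]_1[EFin \o u])%E.
Proof.
move=> t0 q0 q1 u1; elim: n => [|n IH].
  rewrite [X in (Lnorm _ _ X <= _)%E](_ : _ = cst 0%E)//.
  by rewrite Lnorm0 ?Lnorm_ge0.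
have q1p : 0 <= 1 - q by rewrite subr_ge0.
have p1 : (neumann t q u n : X -> R) \in Lfun mu 1.
  by apply: Lfun1P; exact: le_lt_trans IH (Lfun1_fin u1).
have Tp := le_trans (sg_contraction1 sgT t0 p1) IH.
move: Tp; rewrite !Lnorm1 => Tp.
apply: (@le_trans _ _ (\int[mu]_x (q%:E * `|(u x)%:E| +
    (1 - q)%:E * `|(T t (neumann t q u n) x)%:E|))%E).
  apply: ge0_le_integral => //.
  - by apply: measurableT_comp => //; apply/measurable_EFinP.
  - by apply: emeasurable_funD; apply: measurable_funeM;
      apply: measurableT_comp => //; apply/measurable_EFinP.
  - move=> x _; rewrite /= -!EFinM -EFinD lee_fin.
    apply: (le_trans (ler_normD (q * u x) ((1 - q) * T t (neumann t q u n) x))).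
    by rewrite !normrM (ger0_norm q0) (ger0_norm q1p).
rewrite ge0_integralD//; last 4 first.
- by move=> x _; rewrite mule_ge0// lee_fin.
- by apply: measurable_funeM; apply: measurableT_comp => //; apply/measurable_EFinP.
- by move=> x _; rewrite mule_ge0// lee_fin subr_ge0.
- by apply: measurable_funeM; apply: measurableT_comp => //; apply/measurable_EFinP.
have mabs f : measurable_fun setT (fun x => `|(f x)%:E|%E).
  by apply: measurableT_comp => //; apply/measurable_EFinP.
rewrite !ge0_integralZl ?lee_fin//.
pose K := (\int[mu]_x `|(u x)%:E|)%E.
apply: (@le_trans _ _ (q%:E * K + (1 - q)%:E * K)%E).
  by rewrite leeD2l// lee_wpmul2l// lee_fin.
by rewrite -ge0_muleDl ?lee_fin// -EFinD addrC subrK mul1e.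
Qed.

(** If [u = v + s w], then [v] solves the fixed-point equation with [u] replaced
    by [u - s g], so [v - p_(n+1) = q (- s g) + (1 - q) T_t (v - p_n)] is a convex
    combination; the convexity of the squared norm gives the geometric decay.
    For [w = A v], [g] tends to [0] with [t]. *)
Lemma neumann_dist t s q u v w g n : 0 < t -> 0 < s -> q = t / (t + s) ->
  (forall x, u x = v x + s * w x) -> g = t^-1 *: (T t v - v) - - w ->
  dot mu (v \- neumann t q u n) (v \- neumann t q u n) <=
  s ^+ 2 * dot mu g g + (1 - q) ^+ n * dot mu v v.
Proof.
move=> t0 s0 qE uE gE.
have ts0 : 0 < t + s by rewrite addr_gt0.
have q0 : 0 <= q by rewrite qE divr_ge0 ?ltW.
have q1 : q <= 1 by rewrite qE ler_pdivrMr// mul1r lerDl ltW.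
elim: n => [|n IH].
  rewrite expr0 mul1r (_ : v \- _ = v); first by rewrite lerDr mulr_ge0 ?sqr_ge0 ?dot_ge0.
  by apply/funext => x /=; rewrite subr0.
set p := neumann t q u n in IH *.
pose a : L2 mu := (- s) *: g.
pose b : L2 mu := T t (-1 *: p + v).
have -> : dot mu (v \- neumann t q u n.+1) (v \- neumann t q u n.+1) =
    dot mu (q *: a + (1 - q) *: b) (q *: a + (1 - q) *: b).
  have e : (v - neumann t q u n.+1 : L2 mu) = q *: a + (1 - q) *: b %[ae mu].
    have := sg_linear sgT (-1) p v t0; apply: filterS => x bE _.
    change (v x - (q * u x + (1 - q) * T t p x) = q * (- s * g x) + (1 - q) * b x).
    have {bE} -> : b x = -1 * T t p x + T t v x by exact: (bE I).
    have -> : g x = t^-1 * (T t v x - v x) - - w x by rewrite gE.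
    by rewrite uE qE; field; rewrite !gt_eqF.
  exact: (dot_ae_eq e e).
apply: (le_trans (@dot_convex q a b q0 q1 (LfunP a) (LfunP b))).
have -> : dot mu a a = s ^+ 2 * dot mu g g.
  by rewrite /a dotZZ ?LfunP// sqrrN.
have bn : dot mu b b <= s ^+ 2 * dot mu g g + (1 - q) ^+ n * dot mu v v.
  apply: le_trans (dot_contraction _ t0) _; apply: le_trans IH.
  rewrite (_ : (-1 *: p + v : L2 mu) = v \- p :> (X -> R))//.
  apply/funext => x; change (-1 * p x + v x = v x - p x).
  by rewrite mulN1r addrC.
have q1' : 0 <= 1 - q by rewrite subr_ge0.
apply: le_trans (lerD (lexx _) (ler_wpM2l q1' bn)) _.
by rewrite le_eqVlt (exprS (1 - q)); apply/orP; left; apply/eqP; ring.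
Qed.

Lemma resolvent_L1 s u v w : 0 < s -> (forall x, u x = v x + s * w x) ->
  generator_graph T v w -> (u : X -> R) \in Lfun mu 1 ->
  ('N[mu]_1[EFin \o v] <= 'N[mu]_1[EFin \o u])%E.
Proof.
move=> s0 uE /cvgL2P gw u1.
rewrite [X in (X <= _)%E]Lnorm1; apply: integral_norm_le_of_L2_approx; first exact: LfunP.
move=> e e0.
have e1 : 0 < e / 2 / (s ^+ 2) by rewrite !divr_gt0// exprn_gt0.
have [t [t0 gt]] : exists t, 0 < t /\
    dot mu (t^-1 *: (T t v - v) - - w : L2 mu)
      (t^-1 *: (T t v - v) - - w : L2 mu) <= e / 2 / (s ^+ 2).
  have /cvgrPdist_le/(_ _ e1) := gw.
  move=> /(filterI (nbhs_right_gt (0 : R)))/filter_ex[t [t0]].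
  by rewrite sub0r normrN ger0_norm ?dot_ge0// => gt; exists t.
pose q := t / (t + s).
have ts0 : 0 < t + s by rewrite addr_gt0.
have q0 : 0 < q by rewrite divr_gt0.
have q1 : q < 1 by rewrite ltr_pdivrMr// mul1r ltrDl.
have [n qn] : exists n, (1 - q) ^+ n * dot mu v v <= e / 2.
  have : (1 - q) ^+ n * dot mu v v @[n --> \oo] --> (0 : R).
    rewrite -(mul0r (dot mu v v)); apply: cvgMr_tmp; apply: cvg_expr.
    by rewrite ger0_norm ?subr_ge0 ?ltW// gtrBl.
  have e2 : 0 < e / 2 by rewrite divr_gt0.
  move=> /cvgrPdist_le/(_ _ e2)[n _ /(_ n (leqnn n))] h; exists n; move: h.
  rewrite sub0r normrN ger0_norm// mulr_ge0 ?dot_ge0// exprn_ge0// subr_ge0 ltW//.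
exists (neumann t q u n); split; first exact: LfunP.
  by have := neumann_L1 n t0 (ltW q0) (ltW q1) u1; rewrite [X in (X <= _)%E -> _]Lnorm1.
apply: le_trans (neumann_dist n t0 s0 erefl uE erefl) _.
have := ler_wpM2l (sqr_ge0 s) gt.
rewrite mulrCA divff ?mulr1 ?sqrf_eq0 ?gt_eqF// => h; rewrite -/q; lra.
Qed.

End semigroup_resolvent.

(** * Decay of the iterated resolvents *)

Lemma nash_beta_le (R : realType) (D beta : R -> R) r x :
  (forall r, 0 < r -> nash_beta D r = (beta r)%:E) -> 0 < r -> 0 < x ->
  x - r * x * D x <= beta r.
Proof.
move=> hb r0 x0; rewrite -lee_fin -hb//; apply: ereal_sup_ubound.
by exists x => //=; rewrite in_itv/= x0.
Qed.

(** The terms of the supremum tend to [0] as [x] does. *)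
Lemma nash_beta_ge0 (R : realType) (D beta : R -> R) r :
  (forall x, 0 <= x -> 0 <= D x) ->
  (forall x y, 0 <= x -> x <= y -> D x <= D y) ->
  (forall r, 0 < r -> nash_beta D r = (beta r)%:E) -> 0 < r -> 0 <= beta r.
Proof.
move=> D0 Dnd hb r0; apply/ler_addgt0Pr => e e0.
have D1 := D0 1 ler01.
have den : 0 < r * (D 1 + 1) + e by rewrite addr_gt0// mulr_gt0// ltr_wpDl.
(* [x <= 1], so that [D x <= D 1], and [r * x * D 1 <= e]. *)
pose x := e / (r * (D 1 + 1) + e).
have x0 : 0 < x by rewrite divr_gt0.
have x1 : x <= 1 by rewrite ler_pdivrMr// mul1r lerDr mulr_ge0 ?ltW// ltr_wpDl.
have := nash_beta_le hb r0 x0.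
have Dx : D x <= D 1 by apply: Dnd => //; exact: ltW.
have rx : 0 <= r * x by rewrite mulr_ge0 ?ltW.
have h1 : r * x * D x <= r * x * D 1 by rewrite ler_wpM2l.
have h2 : r * x * D 1 <= e.
  rewrite /x mulrA -mulrAC ler_pdivrMr// (mulrC r e) -mulrA ler_wpM2l ?(ltW e0)//.
  by rewrite mulrDr mulr1 -addrA lerDl addr_ge0 ?ltW.
lra.
Qed.

Section decay.
Context d (X : measurableType d) (R : realType) (mu : {measure set X -> \bar R}).
Variables (T : R -> L2 mu -> L2 mu) (E : spectral_family mu).
Hypotheses (sgT : contraction_semigroup T) (ET : spectral_resolution E T).
Implicit Types f g h u v w : L2 mu.
Local Notation m := (pv_meas E).

(** The generator, defined through the semigroup, and the functional calculus are
    related through this equivalence only. *)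
Lemma generator_graphP v w :
  generator_graph T v w <-> spectral_value E (@pospart R) v w.
Proof.
rewrite (ET v w); apply: calculus_graphP; first exact: measurable_pospart.
by move=> l l0; rewrite pospart_id.
Qed.

(** Here the nonlinear Nash inequality becomes linear in the squared norm:
    [x - s^-1 x D x <= beta s^-1] at [x = (v, v)]. *)
Lemma super_poincare (D beta : R -> R) s v w :
  (forall x, 0 <= x -> 0 <= D x) ->
  (forall x y, 0 <= x -> x <= y -> D x <= D y) ->
  nash_inequality (generator_dom T) (generator T) (fun x => (D x)%:E) ->
  (forall r, 0 < r -> nash_beta D r = (beta r)%:E) ->
  0 < s -> generator_graph T v w -> (v : X -> R) \in Lfun mu 1 ->
  ('N[mu]_1[EFin \o v] <= 1)%E -> s * (dot mu v v - beta s^-1) <= dot mu w v.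
Proof.
move=> D0 Dnd nash hb s0 vw v1 vle.
have domv : generator_dom T v by exists w.
have gw' : generator_graph T v (generator T v).
  by have := @xgetPex _ 0 [set h | generator_graph T v h] domv.
have e : dot mu (generator T v) v = dot mu w v.
  rewrite (spectral_value_dot (proj1 (generator_graphP _ _) gw')).
  by rewrite (spectral_value_dot (proj1 (generator_graphP _ _) vw)).
have := nash v domv v1 vle; rewrite normsqE -EFinM lee_fin.
rewrite -[inner _ _]/(dot mu (generator T v) v) e => le.
apply: le_trans le; have s0' : 0 < s^-1 by rewrite invr_gt0.
have b0 := nash_beta_ge0 D0 Dnd hb s0'.
have [->|V0] := eqVneq (dot mu v v) 0.
  by rewrite mul0r sub0r mulrN oppr_le0 mulr_ge0// ltW.
have Vp : 0 < dot mu v v by rewrite lt_neqAle eq_sym V0 dot_ge0.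
have := nash_beta_le hb s0' Vp => h.
have : s * (dot mu v v - beta s^-1) <= s * (s^-1 * dot mu v v * D (dot mu v v)).
  by rewrite ler_wpM2l ?(ltW s0)//; lra.
by rewrite !mulrA mulfV ?gt_eqF// mul1r.
Qed.

Variables (s b t : R) (s0 : 0 < s) (t0 : 0 < t).
Hypothesis SP : forall v w, generator_graph T v w -> (v : X -> R) \in Lfun mu 1 ->
  ('N[mu]_1[EFin \o v] <= 1)%E -> s * (dot mu v v - b) <= dot mu w v.
Local Notation phi := (resolvent_symbol t).

(** From [u = v + t A v] one gets
    [(u, u) = (v, v) + 2 t (A v, v) + t ^ 2 (A v, A v)]. Dropping the last term
    leaves an inequality that is affine in [(v, v) - b], and therefore valid
    whatever the sign of this difference. *)
Lemma resolvent_iter f j : (f : X -> R) \in Lfun mu 1 ->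
  ('N[mu]_1[EFin \o f] <= 1)%E -> exists v,
  [/\ (v : X -> R) \in Lfun mu 1, ('N[mu]_1[EFin \o v] <= 1)%E,
    (forall F : R -> R, (forall l, 0 <= F l) -> measurable_fun setT F ->
      \int[m v]_l F l = \int[m f]_l (F l * (phi l ^+ 2) ^+ j)) &
    dot mu v v - b <= (1 + 2 * t * s)^-1 ^+ j * (dot mu f f - b)].
Proof.
move=> f1 fle; elim: j => [|j [u [u1 ule um ud]]].
  exists f; split => //; last by rewrite expr0 mul1r.
  by move=> F _ _; apply: eq_Rintegral => l _; rewrite expr0 mulr1.
have [v [sp spw]] := resolvent_exists E u t0.
set w := t^-1 *: (u - v) in spw.
have uE x : u x = v x + t * w x.
  change (u x = v x + t * (t^-1 * (u x - v x))).
  by rewrite mulrA mulfV ?gt_eqF// mul1r addrC subrK.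
have gw : generator_graph T v w by apply/generator_graphP.
have vle := le_trans (resolvent_L1 sgT t0 uE gw u1) ule.
have v1 : (v : X -> R) \in Lfun mu 1.
  by apply: Lfun1P; rewrite (le_lt_trans vle)// ltry.
exists v; split => //.
- move=> F F0 mF; rewrite (spectral_value_Rintegral sp)// um.
  + by apply: eq_Rintegral => l _; rewrite -mulrA -exprS.
  + by move=> l; rewrite mulr_ge0// sqr_ge0.
  + apply: measurable_funM => //; apply: measurable_funX.
    exact: measurable_resolvent_symbol.
have := SP gw v1 vle => spv.
have U : dot mu u u = dot mu v v + 2 * t * dot mu w v + t ^+ 2 * dot mu w w.
  have -> : (u : X -> R) = v \+ (fun x => t * w x) by apply/funext.
  by rewrite dotDD ?Lfun2Z ?LfunP// dotZZ ?LfunP// dotC dotZl ?LfunP// mulrA.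
have den : 0 < 1 + 2 * t * s by rewrite addr_gt0// !mulr_gt0.
rewrite exprS -mulrA ler_pdivlMl//; apply: le_trans ud; rewrite U.
have ww := dot_ge0 mu w.
have : t * (s * (dot mu v v - b)) <= t * dot mu w v by rewrite ler_wpM2l// ltW.
have : 0 <= t ^+ 2 * dot mu w w by rewrite mulr_ge0// sqr_ge0.
lra.
Qed.

Lemma resolvent_decay f j : (f : X -> R) \in Lfun mu 1 ->
  ('N[mu]_1[EFin \o f] <= 1)%E ->
  \int[m f]_l (phi l ^+ 2) ^+ j - b <= (1 + 2 * t * s)^-1 ^+ j * (dot mu f f - b).
Proof.
move=> f1 fle; have [v [_ _ vm vd]] := resolvent_iter j f1 fle.
have e : dot mu v v = \int[m f]_l (phi l ^+ 2) ^+ j.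
  transitivity (\int[m v]_l (1 : R)).
    by rewrite Rintegral_cst// mul1r pv_meas_setT.
  by rewrite vm//; apply: eq_Rintegral => l _; rewrite mul1r.
by rewrite -e.
Qed.
End decay.

(** * Taylor expansions with nonnegative derivatives *)

Section taylor.
Context {R : realType}.
Implicit Types (F : nat -> R -> R) (f df : R -> R) (a x y t u : R).

Lemma le_of_derive_ge0 f df x y : x <= y ->
  (forall z, x <= z -> z <= y -> is_derive z 1 f (df z)) ->
  (forall z, x <= z -> z <= y -> 0 <= df z) -> f x <= f y.
Proof.
move=> xy fd df0; have [||c] := @MVT_segment _ f df x y xy.
- by move=> z; rewrite in_itv/= => /andP[xz zy]; apply: fd; exact: ltW.
- apply: derivable_within_continuous => z; rewrite in_itv/= => /andP[xz zy].
  by have [] := fd z xz zy.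
rewrite in_itv/= => /andP[xc cy] e.
by rewrite -subr_ge0 e mulr_ge0 ?subr_ge0// df0.
Qed.

(** [F k] stands for the derivative of order [k] of [F 0]: [shift_family] is
    differentiation, under which both the polynomials and the remainders are
    stable, so that the inductions below are on families. *)
Definition taylor_poly F n : {poly R} := \poly_(k < n) (F k 0 / k`!%:R).
Definition taylor_rem F n x := F 0%N x - (taylor_poly F n).[x].
Definition shift_family F : nat -> R -> R := fun k => F k.+1.

Lemma taylor_poly_deriv F n : (taylor_poly F n.+1)^`() = taylor_poly (shift_family F) n.
Proof.
apply/polyP => k; rewrite coef_deriv !coef_poly ltnS.
case: ltnP => // _; last by rewrite mul0rn.
rewrite /shift_family factS natrM -mulr_natr; field.
by rewrite pnatr_eq0 -lt0n fact_gt0 gt_eqF// ltr_pwDl// ler0n.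
Qed.

Definition derives_below a F := forall k x, x < a -> is_derive x 1 (F k) (F k.+1 x).

Lemma derives_below_shift a F : derives_below a F -> derives_below a (shift_family F).
Proof. by move=> dF k; exact: dF. Qed.

Lemma taylor_rem_derive a F n x : derives_below a F -> x < a ->
  is_derive x 1 (taylor_rem F n.+1) (taylor_rem (shift_family F) n x).
Proof.
move=> dF xa; have d1 := dF 0%N x xa.
have d2 := is_derive_poly (taylor_poly F n.+1) x.
by rewrite /taylor_rem -taylor_poly_deriv; exact: is_deriveB.
Qed.

Lemma taylor_rem0 F n : taylor_rem F n.+1 0 = 0.
Proof. by rewrite /taylor_rem horner_coef0 coef_poly/= divr1 subrr. Qed.

Lemma taylor_rem_ge0 a F n x : derives_below a F ->
  (forall y, y < a -> 0 <= F n y) -> 0 <= x -> x < a -> 0 <= taylor_rem F n x.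
Proof.
elim: n F x => [|n IH] F x dF F0 x0 xa.
  by rewrite /taylor_rem /taylor_poly poly_def big_ord0 horner0 subr0 F0.
rewrite -(taylor_rem0 F n); apply: (le_of_derive_ge0 x0) => z z0 zx.
  by apply: (taylor_rem_derive _ dF); exact: le_lt_trans xa.
by apply: (IH (shift_family F)) => //; [exact: derives_below_shift|exact: le_lt_trans xa].
Qed.

(** If all the derivatives of [F 0] are nonnegative, the remainder divided by
    [x ^+ n] is nondecreasing, because this property passes from the derivative
    of a function vanishing at [0] to the function. It gives a geometric bound
    away from the end of the interval. *)
Lemma taylor_rem_scale a F n t x : derives_below a F ->
  (forall k y, y < a -> 0 <= F k.+1 y) -> 0 <= t -> t <= 1 -> 0 <= x -> x < a ->
  taylor_rem F n (t * x) <= t ^+ n * taylor_rem F n x.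
Proof.
elim: n F x => [|n IH] F x dF F0 t0 t1 x0 xa.
  rewrite expr0 mul1r /taylor_rem /taylor_poly poly_def big_ord0 !horner0 !subr0.
  apply: (@le_of_derive_ge0 _ (F 1%N)); first by rewrite ler_piMl.
    by move=> z _ zx; apply: dF; exact: le_lt_trans xa.
  by move=> z _ zx; apply: F0; exact: le_lt_trans xa.
pose h y := t ^+ n.+1 * taylor_rem F n.+1 y - taylor_rem F n.+1 (t * y).
suff : h 0 <= h x by rewrite /h mulr0 taylor_rem0 mulr0 subr0 subr_ge0.
apply: (@le_of_derive_ge0 _ (fun y => t ^+ n.+1 * taylor_rem (shift_family F) n y -
    t * taylor_rem (shift_family F) n (t * y))) => // z z0 zx.
- have za := le_lt_trans zx xa.
  have tza : t * z < a by apply: le_lt_trans za; rewrite ler_piMl.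
  have d1 := taylor_rem_derive n dF za.
  have d2 := taylor_rem_derive n dF tza.
  have d3 : is_derive z 1 (fun y => t * y) t.
    by apply: is_derive_eq; rewrite /GRing.scale /= mulr1.
  have d4 := is_derive1_comp d2 d3.
  have d5 : is_derive z 1 (fun y => t ^+ n.+1 * taylor_rem F n.+1 y)
      (t ^+ n.+1 * taylor_rem (shift_family F) n z) by exact: is_deriveZ.
  by have := is_deriveB d5 d4; rewrite (mulrC _ t).
- rewrite exprS -mulrA -mulrBr mulr_ge0// subr_ge0; apply: IH => //.
  + exact: derives_below_shift.
  + by move=> k y; exact: (F0 k.+1).
  + exact: le_lt_trans xa.
Qed.

End taylor.

(** * Bernstein functions *)

Section bernstein_functions.
Context {R : realType}.
Variable g : R -> R.
Hypothesis bg : bernstein g.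
Implicit Types (a x y s t : R).

Lemma bernstein_is_derive n s : 0 < s ->
  is_derive s 1 (derive1n n g) (derive1n n.+1 g s).
Proof.
move=> s0; rewrite derive1nS derive1E.
by apply: DeriveDef => //; exact: (bernstein_smooth bg).
Qed.

Lemma bernstein_continuous s : 0 < s -> {for s, continuous g}.
Proof.
move=> s0; have [d _] := bernstein_is_derive 0 s0; rewrite derive1n0 in d.
by apply: differentiable_continuous; exact/derivable1_diffP.
Qed.

(** The derivatives of [u |-> - g (a - u)], which are nonnegative from the order 1
    on. *)
Definition bernstein_family a : nat -> R -> R :=
  fun k u => (-1) ^+ k.+1 * derive1n k g (a - u).

Lemma bernstein_family_derives a : derives_below a (bernstein_family a).
Proof.
move=> k x xa; have ax : 0 < a - x by rewrite subr_gt0.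
have d1 := bernstein_is_derive k ax.
have d2 : is_derive x 1 (fun u => a - u) (-1).
  by have := is_deriveB (is_derive_cst a x 1) (is_derive_id x 1); rewrite sub0r.
have d3 := @is_derive1_comp _ (derive1n k g) (fun u => a - u) x _ _ d1 d2.
have -> : bernstein_family a k.+1 x =
    (-1) ^+ k.+1 *: (derive1n k.+1 g (a - x) * -1 : R).
  by rewrite /bernstein_family [in LHS]exprS /GRing.scale /=; ring.
exact: (@is_deriveZ _ _ _ _ ((-1) ^+ k.+1) _ _ _ d3).
Qed.

Lemma bernstein_family_ge0 a k y : y < a -> 0 <= bernstein_family a k.+1 y.
Proof.
move=> ya; have := bernstein_sign bg (isT : (1 <= k.+1)%N) (_ : 0 < a - y).
rewrite subr_gt0 => /(_ ya); rewrite subn1 /bernstein_family !exprS.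
by rewrite mulrA mulrNN !mul1r.
Qed.

Lemma bernstein_nd x y : 0 < x -> x <= y -> g x <= g y.
Proof.
move=> x0 xy; apply: (@le_of_derive_ge0 _ _ (derive1n 1 g)) => // z xz _.
  by have := bernstein_is_derive 0 (lt_le_trans x0 xz).
by have := bernstein_sign bg (leqnn 1) (lt_le_trans x0 xz); rewrite subnn mul1r.
Qed.

Lemma bernstein_derive_ni x y : 0 < x -> x <= y -> derive1n 1 g y <= derive1n 1 g x.
Proof.
move=> x0 xy; rewrite -lerN2.
apply: (@le_of_derive_ge0 _ (fun z => - derive1n 1 g z)
  (fun z => - derive1n 2 g z)) => // z xz _.
  exact: is_deriveN (bernstein_is_derive 1 (lt_le_trans x0 xz)).
have := bernstein_sign bg (isT : (1 <= 2)%N) (lt_le_trans x0 xz).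
by rewrite subn1 expr1 mulN1r.
Qed.

Lemma bernstein_increment_ni x y e : 0 < x -> x <= y -> 0 <= e ->
  g (y + e) - g y <= g (x + e) - g x.
Proof.
move=> x0 xy e0; rewrite -lerN2.
apply: (@le_of_derive_ge0 _ (fun z => - (g (z + e) - g z))
  (fun z => - (derive1n 1 g (z + e) - derive1n 1 g z))) => // z xz _.
- have z0 := lt_le_trans x0 xz; have ze0 : 0 < z + e by rewrite ltr_wpDr.
  apply: is_deriveN; apply: is_deriveB; last exact: (bernstein_is_derive 0 z0).
  have d2 : is_derive z 1 (fun u => u + e) 1.
    by have := is_deriveD (is_derive_id z 1) (is_derive_cst e z 1); rewrite addr0.
  have := @is_derive1_comp _ _ (fun u => u + e) z _ _ (bernstein_is_derive 0 ze0) d2.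
  by rewrite mulr1.
- have z0 := lt_le_trans x0 xz.
  by rewrite oppr_ge0 subr_le0 bernstein_derive_ni// lerDl.
Qed.

Lemma bernstein_scale_ni x y t : 0 < x -> x <= y -> 0 < t -> t <= 1 ->
  g (t * x) - t * g x <= g (t * y) - t * g y.
Proof.
move=> x0 xy t0 t1.
apply: (@le_of_derive_ge0 _ (fun z => g (t * z) - t * g z)
  (fun z => derive1n 1 g (t * z) * t - t * derive1n 1 g z)) => // z xz _.
- have z0 := lt_le_trans x0 xz; have tz0 : 0 < t * z by rewrite mulr_gt0.
  apply: is_deriveB; last first.
    exact: (@is_deriveZ _ _ _ _ t _ _ _ (bernstein_is_derive 0 z0)).
  have d2 : is_derive z 1 (fun u => t * u) t.
    by apply: is_derive_eq; rewrite /GRing.scale /= mulr1.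
  exact: (@is_derive1_comp _ _ (fun u => t * u) z _ _ (bernstein_is_derive 0 tz0) d2).
- have z0 := lt_le_trans x0 xz.
  rewrite mulrC -mulrBr mulr_ge0 ?(ltW t0)// subr_ge0 bernstein_derive_ni ?mulr_gt0//.
  by rewrite ler_piMl// ltW.
Qed.

Let values := [set g x | x in `]0, +oo[].

Lemma has_lbound_values : has_lbound values.
Proof.
exists 0 => y [x /=]; rewrite in_itv/= andbT => x0 <-; exact/ltW/(bernstein_gt0 bg).
Qed.

Lemma bernstein_cvg_inf : g x @[x --> 0^'+] --> inf values.
Proof.
apply: (@nondecreasing_at_right_cvgr _ g 0 +oo%O) => //; last exact: has_lbound_values.
move=> x y; rewrite !in_itv/= !andbT => x0 _ xy; exact: bernstein_nd.
Qed.

Lemma bernstein_at0E : bernstein_at0 g = inf values.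
Proof. by apply: cvg_lim => //; exact: bernstein_cvg_inf. Qed.

Lemma bernstein_cvg_at0 : g x @[x --> 0^'+] --> bernstein_at0 g.
Proof. by rewrite bernstein_at0E; exact: bernstein_cvg_inf. Qed.

Lemma bernstein_at0_le s : 0 < s -> bernstein_at0 g <= g s.
Proof.
move=> s0; rewrite bernstein_at0E; apply: ge_inf; first exact: has_lbound_values.
by exists s => //=; rewrite in_itv/= s0.
Qed.

Lemma bernstein_at0_ge0 : 0 <= bernstein_at0 g.
Proof.
rewrite bernstein_at0E; apply: lb_le_inf.
  by exists (g 1), 1 => //=; rewrite in_itv/= ltr01.
move=> y [x /=]; rewrite in_itv/= andbT => x0 <-; exact/ltW/(bernstein_gt0 bg).
Qed.

(** The increment [g (l + e) - g l] is nonincreasing in [l], so that its value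
    at [0+] dominates; this is the concavity of [g]. *)
Lemma bernstein_ext_shift l e : 0 <= l -> 0 < e ->
  g (l + e) <= bernstein_ext g l + (g e - bernstein_at0 g).
Proof.
rewrite le_eqVlt => /predU1P[<- _|l0 e0].
  by rewrite add0r /bernstein_ext ltxx addrC subrK.
rewrite /bernstein_ext l0 -lerBlDl.
have c : g (x + e) - g x @[x --> 0^'+] --> g e - bernstein_at0 g.
  apply: cvgB; last exact: bernstein_cvg_at0.
  apply: cvg_at_right_filter.
  apply: (@continuous_cvg _ _ _ _ _ (fun x => x + e) g).
    exact: bernstein_continuous.
  by rewrite -[X in _ --> X]add0r; apply: cvgD; [exact: cvg_id|exact: cvg_cst].
rewrite -(cvg_lim _ c)//; apply: limr_ge; first by apply/cvg_ex; eexists; exact: c.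
near=> x; apply: bernstein_increment_ni => //; last exact: ltW.
by near: x; exact: nbhs_right_le.
Unshelve. all: by end_near. Qed.

Lemma bernstein_ext_ge0 l : 0 <= bernstein_ext g l.
Proof.
rewrite /bernstein_ext; case: ifP => [l0|_]; first exact/ltW/(bernstein_gt0 bg).
exact: bernstein_at0_ge0.
Qed.

Lemma bernstein_ext_nd x y : x <= y -> bernstein_ext g x <= bernstein_ext g y.
Proof.
move=> xy; rewrite /bernstein_ext; case: ifP => [x0|_].
  by rewrite (lt_le_trans x0 xy) bernstein_nd.
by case: ifP => // y0; exact: bernstein_at0_le.
Qed.

Lemma measurable_bernstein_ext : measurable_fun setT (bernstein_ext g).
Proof. by apply: nondecreasing_measurable => //; exact: bernstein_ext_nd. Qed.

End bernstein_functions.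

(** * Integrals of Bernstein functions from moment bounds *)

Section moment_comparison.
Context d (T : measurableType d) (R : realType) (m : {measure set T -> \bar R}).
Hypothesis mfin : (m setT < +oo)%E.
Variables (X : T -> R) (c y : R).
Hypotheses (mX : measurable_fun setT X) (X0 : forall l, 0 <= X l)
  (X1 : forall l, X l <= 1).
Local Notation M := (fine (m setT)).
Hypotheses (c0 : 0 <= c) (cM : c <= M) (y0 : 0 <= y) (y1 : y <= 1).
Hypothesis momX : forall j, \int[m]_l X l ^+ j <= M - c + y ^+ j * c.

Lemma moment_integrable j : m.-integrable setT (EFin \o (fun l => X l ^+ j)).
Proof.
have X2 : (fun l => X l ^+ j) \in Lfun m 2%:E.
  apply: (@Lfun2_bounded _ _ _ _ _ 1) => //; first exact: measurable_funX.
  by move=> l; rewrite ger0_norm ?exprn_ge0// exprn_ile1.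
have := dot_integrable X2 (Lfun2_indic mfin measurableT).
by apply: eq_integrable => // l _; rewrite /= indicT mulr1.
Qed.

Lemma cst_integrable (k : R) : m.-integrable setT (EFin \o (fun _ : T => k)).
Proof.
have := integrableZl measurableT k (moment_integrable 0).
by apply: eq_integrable => // l _; rewrite /= ?expr0 ?mule1 ?mulr1.
Qed.

(** The moment bounds are linear, with equality at [j = 0], so they pass to
    polynomials whose coefficients of positive order are nonnegative. *)
Lemma poly_integral (p : {poly R}) k : 0 <= k -> (forall i, 0 <= p`_i.+1) ->
  m.-integrable setT (EFin \o (fun l => p.[k * X l])) /\
  \int[m]_l p.[k * X l] <= (M - c) * p.[k] + c * p.[k * y].
Proof.
move=> k0 p0.
have pE l : p.[k * X l] = \sum_(i < size p) (p`_i * k ^+ i) * X l ^+ i.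
  by rewrite horner_coef; apply: eq_bigr => i _; rewrite exprMn mulrA.
have i1 (i : 'I_(size p)) : m.-integrable setT
    (EFin \o (fun l => p`_i * k ^+ i * X l ^+ i)).
  exact: (integrableZl measurableT (p`_i * k ^+ i) (moment_integrable i)).
have [i2 e] := Rintegral_sum (index_enum 'I_(size p)) i1.
split.
  rewrite (_ : (fun l => _) =
    (fun l => \sum_(i < size p) (p`_i * k ^+ i) * X l ^+ i))//.
  exact/funext.
under eq_Rintegral do rewrite pE.
rewrite e !horner_coef !mulr_sumr -big_split/=; apply: ler_sum => i _.
rewrite RintegralZl//; last exact: moment_integrable.
rewrite exprMn !mulrA -(mulrA _ p`_i) -mulrA.
have -> : (M - c) * (p`_i * k ^+ i) + c * p`_i * (k ^+ i * y ^+ i) =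
  p`_i * k ^+ i * (M - c + y ^+ i * c) by ring.
case: i {i1 i2 e} => -[|i] /= _.
  by rewrite !expr0 mul1r subrK Rintegral_cst// mul1r.
by rewrite ler_wpM2l// mulr_ge0 ?exprn_ge0.
Qed.

Variable g : R -> R.
Hypothesis bg : bernstein g.
Variables (a k eta : R) (Psi : T -> R).
Hypotheses (k0 : 0 < k) (ka : k < a) (iPsi : m.-integrable setT (EFin \o Psi))
  (gPsi : forall l, g (a - k * X l) - eta <= Psi l).

(** With [p] the Taylor polynomial at [0] of [u |-> - g (a - u)],
    [g (a - k w)] is [- p.[k * w]] up to a remainder that is nonnegative and, as
    [k < a], bounded on [0, 1] by a geometric sequence in [n]. The sign of the
    remainder gives [p.[k] <= - g (a - k) <= 0], so the term of [poly_integral]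
    in [M - c] can be dropped. *)
Lemma bernstein_moment_le : c * g (a - k * y) - eta * M <= \int[m]_l Psi l.
Proof.
pose F := bernstein_family g a.
have dF : derives_below a F by exact: bernstein_family_derives.
have F0 i z : z < a -> 0 <= F i.+1 z by exact: bernstein_family_ge0.
have [z kz za] : exists2 z, k < z & z < a.
  by exists ((k + a) / 2); have [] := midf_lt ka.
have z0 : 0 < z := lt_trans k0 kz.
have kge0 := ltW k0; have zge0 := ltW z0.
pose C n := taylor_rem F n.+1 z.
have C0 n : 0 <= C n.
  by apply: (@taylor_rem_ge0 _ a) => // w; exact: F0.
have remle n (w : R) : 0 <= w -> w <= 1 ->
    taylor_rem F n.+1 (k * w) <= (k / z) ^+ n.+1 * C n.
  move=> w0 w1; have -> : k * w = (k * w / z) * z by rewrite divfK ?gt_eqF.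
  have kw0 : 0 <= k * w / z by rewrite divr_ge0 ?mulr_ge0.
  have kwz : k * w / z <= k / z by rewrite ler_wpM2r ?invr_ge0// ler_piMr.
  have kz1 : k / z <= 1 by rewrite ler_pdivrMr// mul1r ltW.
  apply: le_trans (@taylor_rem_scale _ a F n.+1 (k * w / z) z dF F0 kw0 _ (ltW z0) za) _.
    exact: le_trans kz1.
  by rewrite ler_wpM2r ?C0// ?lerXn2r ?nnegrE// ?divr_ge0//; exact: C0.
have Cle n : C n <= F 0%N z - F 0%N 0.
  rewrite lerD2l lerN2 horner_poly big_ord_recl/= expr0 mulr1 divr1 lerDl.
  rewrite sumr_ge0// => i _.
  by rewrite mulr_ge0 ?exprn_ge0 ?(ltW z0)// divr_ge0// F0// (lt_trans k0 ka).
have gE w : g (a - w) = - F 0%N w.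
  by rewrite /F /bernstein_family expr1 mulN1r opprK derive1n0.
have main n : c * g (a - k * y) - eta * M <=
    \int[m]_l Psi l + (k / z) ^+ n.+1 * (F 0%N z - F 0%N 0) * M.
  pose p := taylor_poly F n.+1.
  have p0 i : 0 <= p`_i.+1.
    rewrite /p coef_poly; case: ifP => // _; rewrite divr_ge0//.
    by apply: F0; exact: lt_trans ka.
  have [ip lep] := poly_integral (ltW k0) p0.
  have FE w : F 0%N w = p.[w] + taylor_rem F n.+1 w by rewrite /taylor_rem addrC subrK.
  have ie := cst_integrable ((k / z) ^+ n.+1 * C n + eta).
  have isum : m.-integrable setT
      (EFin \o (fun l => p.[k * X l] + ((k / z) ^+ n.+1 * C n + eta))).
    exact: (integrableD measurableT ip ie).
  have ile : \int[m]_l (- (p.[k * X l] + ((k / z) ^+ n.+1 * C n + eta))) <=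
      \int[m]_l Psi l.
    apply: le_Rintegral => //.
      by have := integrableN isum; exact: eq_integrable.
    move=> l _; apply: le_trans (gPsi l); rewrite gE FE.
    by have := remle n (X l) (X0 l) (X1 l); rewrite -/p; lra.
  have iE : \int[m]_l (- (p.[k * X l] + ((k / z) ^+ n.+1 * C n + eta))) =
      - (\int[m]_l p.[k * X l] + ((k / z) ^+ n.+1 * C n + eta) * M).
    rewrite -Rintegral_cst// -RintegralD// -[RHS]mulN1r -RintegralZl//.
    by apply: eq_Rintegral => l _; rewrite mulN1r.
  rewrite {}iE in ile.
  have M0 : 0 <= M := le_trans c0 cM.
  have r0 : 0 <= taylor_rem F n.+1 (k * y).
    apply: (@taylor_rem_ge0 _ a) => //; first by move=> w; exact: F0.
      exact: mulr_ge0.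
    by apply: le_lt_trans ka; rewrite ler_piMr// ltW.
  have pk : p.[k] <= 0.
    have rk : 0 <= taylor_rem F n.+1 k.
      by apply: (@taylor_rem_ge0 _ a) => // w; exact: F0.
    have : 0 < g (a - k) by apply: (bernstein_gt0 bg); rewrite subr_gt0.
    by rewrite gE FE -/p; lra.
  have q0 : 0 <= (k / z) ^+ n.+1 by rewrite exprn_ge0// divr_ge0.
  have h1 : (M - c) * p.[k] <= 0 by rewrite mulr_ge0_le0// subr_ge0.
  have h2 : (k / z) ^+ n.+1 * C n * M <= (k / z) ^+ n.+1 * (F 0%N z - F 0%N 0) * M.
    by rewrite ler_wpM2r// ler_wpM2l.
  have h3 : 0 <= c * taylor_rem F n.+1 (k * y) by rewrite mulr_ge0.
  rewrite gE FE -/p; rewrite mulrDl in ile; nra.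
apply/ler_addgt0Pr => e e0.
pose K := (F 0%N z - F 0%N 0) * M.
have : (k / z) ^+ n.+1 * K @[n --> \oo] --> (0 : R).
  rewrite -(mul0r K); apply: cvgMr_tmp; rewrite cvg_shiftS; apply: cvg_expr.
  by rewrite ger0_norm ?divr_ge0// ltr_pdivrMr// mul1r.
move=> /cvgr_le /(_ _ e0)[n _ /(_ n (leqnn n))] nK.
by apply: le_trans (main n) _; rewrite lerD2l -mulrA.
Qed.

End moment_comparison.

(** * The Nash inequality of the subordinated operator *)

Section subordination.
Context d (X : measurableType d) (R : realType) (mu : {measure set X -> \bar R}).
Variables (T : R -> L2 mu -> L2 mu) (E : spectral_family mu) (g : R -> R).
Hypotheses (sgT : contraction_semigroup T) (ET : spectral_resolution E T).
Hypothesis bg : bernstein g.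
Implicit Types f h u v w : L2 mu.
Local Notation m := (pv_meas E).

Lemma bernstein_ext_pospart l : bernstein_ext g (pospart l) = bernstein_ext g l.
Proof.
rewrite /pospart; case: (leP 0 l) => // l0.
by rewrite /bernstein_ext ltxx ltNge (ltW l0).
Qed.

Lemma nash_bernstein_bound f s b : 0 < s -> 0 <= b ->
  (forall v w, generator_graph T v w -> (v : X -> R) \in Lfun mu 1 ->
    ('N[mu]_1[EFin \o v] <= 1)%E -> s * (dot mu v v - b) <= dot mu w v) ->
  bernstein_ext g \in Lfun (m f) 2%:E ->
  (f : X -> R) \in Lfun mu 1 -> ('N[mu]_1[EFin \o f] <= 1)%E ->
  g s * (dot mu f f - b) <= \int[m f]_l bernstein_ext g l.
Proof.
move=> s0 b0 SP g2 f1 fle.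
have gi : (m f).-integrable setT (EFin \o bernstein_ext g) := Lfun2_pv_integrable g2.
have [fb|bf] := leP (dot mu f f) b.
  apply: (@le_trans _ _ 0).
    by rewrite mulr_ge0_le0 ?subr_le0// ltW// (bernstein_gt0 bg).
  by apply: Rintegral_ge0 => l _; exact: bernstein_ext_ge0.
have Mf : fine (m f setT) = dot mu f f by rewrite pv_meas_setT.
have key e : 0 < e -> e < s ->
    g s * (dot mu f f - b) - (g e - bernstein_at0 g) * dot mu f f <=
    \int[m f]_l bernstein_ext g l.
  move=> e0 es; have se0 : 0 < s - e by rewrite subr_gt0.
  (* This [t] solves [e + k * (1 - y) = s] for [k = (2 * t)^-1]. *)
  pose t := e / (2 * s * (s - e)).
  have t0 : 0 < t by rewrite divr_gt0// !mulr_gt0.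
  pose k := s * (s - e) / e.
  have k0 : 0 < k by rewrite divr_gt0// mulr_gt0.
  have tk : t * k = 2^-1 by rewrite /t /k; field; rewrite !gt_eqF.
  pose y := (1 + 2 * t * s)^-1.
  have yE : y = (s - e) / s.
    by rewrite /y /t; field; rewrite !gt_eqF//=.
  have y0 : 0 <= y by rewrite yE divr_ge0 ?ltW.
  have y1 : y <= 1 by rewrite yE ler_pdivrMr// mul1r gerBl ltW.
  have e2 : (k + e) - k * y = s by rewrite yE /k; field; rewrite !gt_eqF.
  rewrite -Mf -[in g s]e2 mulrC.
  apply: (@bernstein_moment_le _ _ _ (m f) (pv_meas_fin E f)
    (fun l => resolvent_symbol t l ^+ 2)) => //.
  - by apply: measurable_funX; exact: measurable_resolvent_symbol.
  - by move=> l; rewrite sqr_ge0.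
  - by move=> l; rewrite exprn_ile1 ?resolvent_symbol_ge0 ?resolvent_symbol_le1.
  - by rewrite Mf subr_ge0 ltW.
  - by rewrite Mf gerBl.
  - move=> j; have := resolvent_decay sgT ET s0 t0 SP j f1 fle.
    by rewrite Mf -/y; lra.
  - by rewrite ltrDl.
  - move=> l; rewrite lerBlDr -bernstein_ext_pospart.
    have p0 := pospart_ge0 l.
    apply: le_trans (bernstein_ext_shift bg p0 e0).
    have den := resolvent_den_ge1 l t0.
    pose phi := resolvent_symbol t l.
    have phiE : phi * (1 + t * pospart l) = 1.
      by rewrite /phi /resolvent_symbol mulVf// gt_eqF// (lt_le_trans ltr01).
    have phi1 : phi <= 1 := resolvent_symbol_le1 l t0.
    have phi0 : 0 <= phi := resolvent_symbol_ge0 l t0.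
    have h : k - k * phi ^+ 2 = pospart l * phi * ((1 + phi) / 2).
      have -> : k - k * phi ^+ 2 = k * (1 - phi) * (1 + phi) by ring.
      rewrite /phi resolvent_symbolE// -/phi.
      have -> : k * (t * (pospart l * phi)) = t * k * (pospart l * phi) by ring.
      by rewrite tk; field.
    apply: (bernstein_nd bg).
      have : 0 <= k - k * phi ^+ 2 by rewrite h !mulr_ge0// addr_ge0.
      by rewrite -/phi; lra.
    suff : k - k * phi ^+ 2 <= pospart l by rewrite -/phi; lra.
    rewrite h -mulrA ler_piMr// mulr_ile1 ?divr_ge0 ?addr_ge0//.
    by rewrite ler_pdivrMr// mul1r -/phi; lra.
have c : g s * (dot mu f f - b) - (g e - bernstein_at0 g) * dot mu f f @[e --> 0^'+] -->
    g s * (dot mu f f - b) - (bernstein_at0 g - bernstein_at0 g) * dot mu f f.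
  apply: cvgB; first exact: cvg_cst.
  apply: cvgMr_tmp; apply: cvgB; last exact: cvg_cst.
  exact: bernstein_cvg_at0.
rewrite subrr mul0r subr0 in c.
rewrite -(cvg_lim _ c)//; apply: limr_le; first by apply/cvg_ex; eexists; exact: c.
near=> e; apply: key => //.
Unshelve. all: by end_near. Qed.

(** [calculus] is chosen arbitrarily in its graph, so its value is known only
    once the graph is inhabited. *)
Lemma calculusE f : calculus_dom E (bernstein_ext g) f ->
  bernstein_ext g \in Lfun (m f) 2%:E /\
  dot mu (calculus E (bernstein_ext g) f) f = \int[m f]_l bernstein_ext g l.
Proof.
have mg := measurable_bernstein_ext bg.
have P := @calculus_graphP _ _ _ _ E (bernstein_ext g) _ f _ mg (fun _ _ => erefl).
move=> /(calculus_domP E f mg (fun _ _ => erefl)) g2; split => //.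
have [h sp] := spectral_value_exists (bernstein_ext_ge0 bg) g2.
have gr : calculus_graph E (bernstein_ext g) f (calculus E (bernstein_ext g) f).
  have := @xgetPex _ 0 [set h | calculus_graph E (bernstein_ext g) f h].
  by apply; exists h; apply/P.
exact: (spectral_value_dot (proj1 (P _) gr)).
Qed.

End subordination.

(** * Comparison of the rate functions *)

Section rates.
Context {R : realType}.
Variables (D g beta : R -> R).
Hypothesis bg : bernstein g.
Implicit Types (r s x : R).
Local Notation ginv := ('pinv_(fun=> 0) `]0, +oo[ g).

Lemma bernstein_atooE :
  bernstein_atoo g = ereal_sup (range (fun x => (bernstein_ext g x)%:E)).
Proof.
have c : (bernstein_ext g x)%:E @[x --> +oo] -->
    ereal_sup (range (fun x => (bernstein_ext g x)%:E)).
  by apply: nondecreasing_cvge => x y xy; rewrite lee_fin bernstein_ext_nd.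
apply: cvg_lim => //; apply: cvg_trans c; apply: near_eq_cvg.
near=> x; rewrite /bernstein_ext ifT//.
Unshelve. all: by end_near. Qed.

Lemma bernstein_le_atoo s : 0 < s -> ((g s)%:E <= bernstein_atoo g)%E.
Proof.
move=> s0; rewrite bernstein_atooE; apply: ereal_sup_ubound.
by exists s => //; rewrite /bernstein_ext s0.
Qed.

Lemma bernstein_surj y : bernstein_at0 g < y -> (y%:E < bernstein_atoo g)%E ->
  exists2 s, 0 < s & g s = y.
Proof.
move=> y0; rewrite bernstein_atooE => /ereal_sup_gt[_ [b _ <-]]; rewrite lte_fin => yb.
have b0 : 0 < b.
  rewrite ltNge; apply/negP => b0; move: yb.
  by rewrite /bernstein_ext (le_gtF b0) ltNge (ltW y0).
rewrite /bernstein_ext b0 in yb.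
have [a [a0 ay]] : exists a, 0 < a /\ g a < y.
  have /cvgr_lt/(_ _ y0) h := bernstein_cvg_at0 bg.
  have hh : nbhs (0 : R)^'+ ((fun x => 0 < x) `&` (fun x => g x < y)).
    by apply: filterI => //; exact: nbhs_right_gt.
  by have [a [a0 ay]] := @filter_ex _ _ (at_right_proper_filter 0) _ hh; exists a.
have ab : a <= b.
  rewrite leNgt; apply/negP => ba; have := bernstein_nd bg b0 (ltW ba).
  by rewrite leNgt (lt_trans ay yb).
have [||c] := @IVT _ g a b y ab.
- apply: derivable_within_continuous => z; rewrite in_itv/= => /andP[az _].
  by have [] := bernstein_is_derive bg 0 (lt_le_trans a0 az).
- by rewrite ge_min (ltW ay)/= le_max (ltW yb) orbT.
by rewrite in_itv/= => /andP[ac _] <-; exists c => //; exact: lt_le_trans ac.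
Qed.

(** The bounds on [r] are exactly what the intermediate value theorem needs for
    [r^-1] to be a value of [g]. *)
Lemma ginvP r : ((bernstein_atoo g)^-1 < r%:E < ((bernstein_at0 g)%:E)^-1)%E ->
  [/\ 0 < r, 0 < ginv r^-1 & g (ginv r^-1) = r^-1].
Proof.
move=> /andP[r1 r2].
have oo0 : (0 <= bernstein_atoo g)%E.
  by apply: le_trans (bernstein_le_atoo ltr01); rewrite lee_fin ltW// (bernstein_gt0 bg).
have r0 : 0 < r.
  by rewrite -lte_fin; apply: le_lt_trans r1; rewrite inve_ge0.
have rE : (r^-1)%:E = (r%:E)^-1%E by rewrite inver gt_eqF.
have y1 : bernstein_at0 g < r^-1.
  rewrite -lte_fin rE -lte_pV2 ?inE ?inve_ge0 ?lee_fin ?(ltW r0)//;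
    last exact: (bernstein_at0_ge0 bg).
  by rewrite inveK// inE ltW.
have y2 : ((r^-1)%:E < bernstein_atoo g)%E.
  rewrite rE -lte_pV2 ?inE ?inve_ge0 ?lee_fin ?(ltW r0)//.
  by rewrite inveK.
have [s s0 gs] := bernstein_surj y1 y2.
have im : r^-1 \in [set g x | x in `]0, +oo[].
  by apply/mem_set; exists s => //=; rewrite in_itv/= s0.
split => //; last exact: pinvK im.
have : [set` `]0, +oo[] (ginv r^-1).
  apply: (@surjpinv_image_sub _ _ (fun=> 0) _ _ g
    (@subset_refl _ [set g x | x in `]0, +oo[])).
  by exists r^-1 => //; exact: set_mem.
by rewrite /= in_itv/= andbT.
Qed.

Lemma bernstein_concave t s : 0 < s -> 0 < t -> t <= 1 -> t * g s <= g (t * s).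
Proof.
move=> s0 t0 t1; rewrite -subr_ge0.
have c : bernstein_at0 g - t * g e @[e --> 0^'+] -->
    bernstein_at0 g - t * bernstein_at0 g.
  apply: cvgB; first exact: cvg_cst.
  by apply: cvgMl_tmp; exact: bernstein_cvg_at0.
apply: (@le_trans _ _ (bernstein_at0 g - t * bernstein_at0 g)).
  by rewrite subr_ge0 ler_piMl// bernstein_at0_ge0.
rewrite -(cvg_lim _ c)//; apply: limr_le; first by apply/cvg_ex; eexists; exact: c.
near=> e; have e0 : 0 < e by [].
have es : e <= s by near: e; exact: nbhs_right_le.
apply: le_trans (bernstein_scale_ni bg e0 es t0 t1).
by rewrite lerD2r bernstein_at0_le// mulr_gt0.
Unshelve. all: by end_near. Qed.

Hypothesis D0 : forall x, 0 <= x -> 0 <= D x.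
Hypothesis Dnd : forall x y, 0 <= x -> x <= y -> D x <= D y.
Hypothesis hb : forall r, 0 < r -> nash_beta D r = (beta r)%:E.

(** The numbers [1 - beta s^-1 / x] are bounded by 1 and by [D x / s]; the first
    bound serves for [s <= D x] and the second one, with concavity, for
    [s > D x]. *)
Lemma D_subordinate_le x : 0 < x ->
  (D_subordinate g beta x <= (bernstein_ext g (D x))%:E)%E.
Proof.
move=> x0; apply: ge_ereal_sup => _ [r /ginvP[r0 s0 gs] <-].
set s := ginv r^-1 in s0 gs *; rewrite lee_fin.
have s0' : 0 < s^-1 by rewrite invr_gt0.
have b0 := nash_beta_ge0 D0 Dnd hb s0'.
have bx := nash_beta_le hb s0' x0.
have gs0 : 0 < g s by rewrite gs invr_gt0.
have -> : r^-1 - (r * x)^-1 * beta s^-1 = g s * (1 - beta s^-1 / x).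
  by rewrite gs invfM; field; rewrite !gt_eqF.
have h1 : 1 - beta s^-1 / x <= 1 by rewrite gerBl divr_ge0// ltW.
have h2 : 1 - beta s^-1 / x <= D x / s.
  rewrite -(ler_pM2r x0) mulrBl divfK ?gt_eqF// mul1r.
  rewrite (_ : D x / s * x = s^-1 * x * D x); first by move: bx; lra.
  by ring.
have Dx0 := D0 (ltW x0).
have [sD|Ds] := leP s (D x).
  apply: (@le_trans _ _ (g s)); first by rewrite ler_piMr// ltW.
  by rewrite /bernstein_ext (lt_le_trans s0 sD) bernstein_nd.
have [D00|D00] := eqVneq (D x) 0.
  apply: (@le_trans _ _ 0); last exact: bernstein_ext_ge0.
  by rewrite mulr_ge0_le0 ?(ltW gs0)//; move: h2; rewrite D00 mul0r.
have Dp : 0 < D x by rewrite lt_neqAle eq_sym D00.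
apply: (@le_trans _ _ (D x / s * g s)); first by rewrite mulrC ler_wpM2r// ltW.
rewrite /bernstein_ext Dp -[leRHS]/(g (D x)) -{2}(divfK (_ : s != 0) (D x)) ?gt_eqF//.
by apply: bernstein_concave => //; rewrite ?divr_gt0// ler_pdivrMr// mul1r ltW.
Qed.

Hypothesis gbij : set_bij `[0, +oo[ `[0, +oo[ (bernstein_ext g).
Hypothesis bbij : set_bij `]0, +oo[ `]0, +oo[ beta.

Lemma bernstein_bij_at0 : bernstein_at0 g = 0.
Proof.
have [_ _ /(_ 0)] := gbij; rewrite /= in_itv/= lexx => /(_ isT)[p _].
rewrite /bernstein_ext; case: ifP => // p0 gp.
by have := bernstein_gt0 bg p0; rewrite gp ltxx.
Qed.

Lemma bernstein_bij_inj : {in `]0, +oo[ &, injective g}.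
Proof.
have [_ inj _] := gbij => x y; rewrite !in_itv/= !andbT => x0 y0 xy.
apply: inj; rewrite ?inE/= ?in_itv/= ?ltW//.
by rewrite /bernstein_ext x0 y0.
Qed.

(** Every [s > 0] is the preimage of an admissible index, [r = (g s)^-1], since an
    injective [g] reaches neither of its limits. *)
Lemma D_subordinate_ge s x : 0 < s -> 0 < x ->
  ((g s * (1 - beta s^-1 / x))%:E <= D_subordinate g beta x)%E.
Proof.
move=> s0 x0; have gs0 := bernstein_gt0 bg s0.
have inj : {in `]0, +oo[%classic &, injective g}.
  by move=> a b /set_mem a0 /set_mem b0; exact: bernstein_bij_inj.
have gK : ginv (g s) = s.
  by rewrite pinvKV// inE/= in_itv/= s0.
apply: ereal_sup_ubound; exists (g s)^-1; last first.
  by rewrite invrK gK; congr EFin; rewrite invfM invrK; ring.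
rewrite /= bernstein_bij_at0 inve0 ltry andbT.
have gss : g s < g (s + 1).
  rewrite lt_neqAle bernstein_nd ?lerDl// andbT; apply/eqP => e.
  have : s = s + 1 by apply: bernstein_bij_inj => //; rewrite in_itv/= ?andbT// addr_gt0.
  lra.
have lt : ((g s)%:E < bernstein_atoo g)%E.
  apply: lt_le_trans (bernstein_le_atoo (addr_gt0 s0 ltr01)).
  by rewrite lte_fin.
have -> : ((g s)^-1)%:E = ((g s)%:E)^-1%E by rewrite inver gt_eqF.
rewrite lte_pV2 ?inE ?lee_fin ?(ltW gs0)//.
by apply: le_trans (ltW lt); rewrite lee_fin ltW.
Qed.

(** With [z = x / rho] and [y = D z], the expression [x' - x' * D x' / y] is at
    most [0] for [x' >= z] and less than [z] for [x' < z]; hence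
    [beta y^-1 <= x / rho]. *)
Lemma D_compose_le x : 0 < x -> (D_compose g D x <= D_subordinate g beta x)%E.
Proof.
move=> x0; apply: ge_ereal_sup => _ [rho + <-]; rewrite /= in_itv/= andbT => rho1.
have rho0 : 0 < rho := lt_trans ltr01 rho1.
pose z := rho^-1 * x; have z0 : 0 < z by rewrite mulr_gt0// invr_gt0.
rewrite -/z; have Dz0 := D0 (ltW z0).
(* If [D z = 0] the left-hand side vanishes, and the index where [beta] takes
   the value [x] shows that the supremum is nonnegative. *)
have [Dz|Dz] := eqVneq (D z) 0.
  rewrite Dz /bernstein_ext ltxx bernstein_bij_at0 mulr0.
  have [_ _ /(_ x)] := bbij; rewrite /= !in_itv/= x0 => /(_ isT)[q].
  rewrite /= in_itv/= andbT => q0 bq.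
  have s0 : 0 < q^-1 by rewrite invr_gt0.
  apply: le_trans (D_subordinate_ge s0 x0).
  by rewrite invrK bq divff ?gt_eqF// subrr mulr0.
pose y := D z; have y0 : 0 < y by rewrite lt_neqAle eq_sym Dz.
rewrite -/y /bernstein_ext y0.
apply: le_trans (D_subordinate_ge y0 x0); rewrite lee_fin mulrC.
apply: ler_wpM2l; first exact/ltW/(bernstein_gt0 bg).
rewrite lerD2l lerN2.
rewrite ler_pdivrMr// -/z -lee_fin -hb ?invr_gt0//.
apply: ge_ereal_sup => _ [x' + <-]; rewrite /= in_itv/= andbT => x'0.
rewrite lee_fin; have [zx|xz] := leP z x'.
  apply: (@le_trans _ _ 0); last exact: ltW.
  have yD : y <= D x' by apply: Dnd => //; exact: ltW.
  rewrite subr_le0 mulrAC ler_peMl ?(ltW x'0)//.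
  by rewrite mulrC ler_pdivlMr// mul1r.
apply: (@le_trans _ _ x'); last exact: ltW.
by rewrite gerBl !mulr_ge0 ?invr_ge0 ?D0 ?ltW.
Qed.

End rates.

Theorem theorem1p2 (R : realType) (d : measure_display) (X : measurableType d)
    (mu : {sigma_finite_measure set X -> \bar R})
    (T : R -> L2 mu -> L2 mu) (E : spectral_family mu)
    (D g : R -> R) (beta : R -> R) :
  contraction_semigroup T ->
  spectral_resolution E T ->
  (forall x, 0 <= x -> 0 <= D x) ->
  (forall x y, 0 <= x -> x <= y -> D x <= D y) ->
  nash_inequality (generator_dom T) (generator T) (fun x => (D x)%:E) ->
  (forall r, 0 < r -> nash_beta D r = (beta r)%:E) ->
  bernstein g ->
  let gA := calculus E (bernstein_ext g) in
  let gA_dom := calculus_dom E (bernstein_ext g) in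
  nash_inequality gA_dom gA (D_subordinate g beta) /\
  (set_bij `[0, +oo[ `[0, +oo[ (bernstein_ext g) ->
   set_bij `]0, +oo[ `]0, +oo[ beta ->
   (forall r s, 0 < r -> r < s -> beta s < beta r) ->
   (forall r, 0 < r -> derivable beta r 1) ->
   nash_inequality gA_dom gA (D_compose g D) /\
   (forall x, 0 < x ->
     (D_compose g D x <= D_subordinate g beta x)%E /\
     (D_subordinate g beta x <= (bernstein_ext g (D x))%:E)%E)).
Proof.
move=> sgT ET D0 Dnd nash hb bg gA gA_dom.
have normsq0 (f : L2 mu) : 0 <= normsq f by rewrite normsqE dot_ge0.
have gAf f : gA_dom f -> (inner (gA f) f)%:E = (\int[pv_meas E f]_l bernstein_ext g l)%:E.
  by move=> /(calculusE bg)[_ <-].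
have nash_sub : nash_inequality gA_dom gA (D_subordinate g beta).
  move=> f domf f1 fle; have [g2 _] := calculusE bg domf.
  rewrite gAf//; set I := \int[_]_l _.
  have [V0|V0] := eqVneq (normsq f) 0.
    rewrite V0 mul0e lee_fin; apply: Rintegral_ge0 => l _.
    exact: bernstein_ext_ge0.
  have Vp : 0 < normsq f by rewrite lt_neqAle eq_sym V0 normsq0.
  rewrite muleC -lee_pdivlMr//.
  apply: ge_ereal_sup => _ [r /(ginvP bg)[r0 s0 gs] <-].
  set s := 'pinv_(fun=> 0) `]0, +oo[ g r^-1 in s0 gs *.
  have s0' : 0 < s^-1 by rewrite invr_gt0.
  have key : g s * (dot mu f f - beta s^-1) <= I.
    apply: (nash_bernstein_bound sgT ET bg s0) => //.
      exact: (nash_beta_ge0 D0 Dnd hb).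
    by move=> v w; exact: (super_poincare ET D0 Dnd nash hb s0).
  rewrite -EFinM lee_fin ler_pdivlMr//; move: key; rewrite -normsqE gs; apply: le_trans.
  by rewrite le_eqVlt; apply/orP; left; apply/eqP; field; rewrite !gt_eqF.
split=> // gbij bbij _ _; have le_sub := D_compose_le bg D0 Dnd hb gbij bbij.
split=> [f domf f1 fle|x x0]; last by split; [exact: le_sub|exact: D_subordinate_le].
apply: le_trans (nash_sub f domf f1 fle).
have [->|V0] := eqVneq (normsq f) 0; first by rewrite !mul0e.
apply: lee_wpmul2l; first by rewrite lee_fin.
by apply: le_sub; rewrite lt_neqAle eq_sym V0 normsq0.
Qed.
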